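(* For every $n\ge 5$ there exist an integer $p$ with $2\le p\le n$ and a continuous family $(Q_t)_{t\in I}$ ($I\subset\mathbb{R}$ an interval of positive length) of pairwise non-congruent $n$-simplices in $\mathbb{R}^{p,n-p}$ such that, for each $(n-2)$-face, the $(n-2)$-volume of that face of $Q_t$ is independent of $t$, and, for every $t\in I$, all the dihedral angles of $Q_t$ are Euclidean angles.
   Context: For $0\le p\le n$, $\mathbb{R}^{p,n-p}$ is the $n$-dimensional real vector space with bilinear product $x\cdot y=x_1y_1+\cdots+x_py_p-x_{p+1}y_{p+1}-\cdots-x_ny_n$. An $n$-simplex in $\mathbb{R}^{p,n-p}$ is the convex hull of $n+1$ affinely independent (labeled) points; its $k$-faces are the $k$-simplices spanned by $k+1$ of its vertices. For a $k$-simplex $G$, choose a vertex as base point and let $u_1,\dots,u_k$ be the vectors from it to the other vertices; the $k$-volume of $G$ is $V_k(G)=|\det(u_i\cdot u_j)_{1\le i,j\le k}|^{1/2}/k!$ (independent of the base point). A continuous family of $n$-simplices is a family indexed by a real interval whose vertices depend continuously on the parameter (faces at different parameters correspond via the vertex labels). Two simplices are congruent if an isometry of $\mathbb{R}^{p,n-p}$ maps one onto the other. The dihedral angle of an $n$-simplex at an $(n-2)$-face is called a Euclidean angle if the orthogonal plane of that $(n-2)$-face in $\mathbb{R}^{p,n-p}$ (the orthogonal complement of its direction space) is a 2-dimensional Euclidean plane, i.e. the bilinear product restricted to it is positive definite. *)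

(* Defs.v *)
From HB Require Import structures.
From mathcomp Require Import all_boot all_order all_algebra.
From mathcomp Require Import all_classical all_reals all_analysis.

Set Implicit Arguments.
Unset Strict Implicit.
Unset Printing Implicit Defensive.

Import Order.TTheory GRing.Theory Num.Theory.
Import numFieldNormedType.Exports.

Local Open Scope classical_set_scope.
Local Open Scope ring_scope.

Section PseudoEuclidean.
Variables (R : realType) (n : nat) (p : nat).
Implicit Types (x y : 'rV[R]_n).

(* The product of R^{p,n-p}; coordinates are numbered from 0. *)
Definition dot x y : R :=
  \sum_(i < n | (i < p)%N) x 0 i * y 0 i
  - \sum_(i < n | (p <= i)%N) x 0 i * y 0 i.

Definition sig_mx : 'M[R]_n :=
  diag_mx (\row_(i < n) (if (i < p)%N then 1 else -1)).

Lemma dot_sig_mx x y : dot x y = (x *m sig_mx *m y^T) 0 0.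
Proof.
rewrite /dot mxE [RHS](bigID (fun i : 'I_n => (i < p)%N)) /=; congr (_ + _).
  by apply: eq_bigr => i ip; rewrite mul_mx_diag !mxE ip mulr1.
rewrite -sumrN; apply: eq_big => [i|i pi]; first by rewrite -leqNgt.
by rewrite mul_mx_diag !mxE ltnNge pi /= mulrN1 mulNr.
Qed.

(* Bijections preserving the (possibly negative) squared distance. They are
   not required to be affine: this is automatic, the product being
   nondegenerate. *)
Definition isometry (f : 'rV[R]_n -> 'rV[R]_n) : Prop :=
  bijective f /\
  forall x y, dot (f x - f y) (f x - f y) = dot (x - y) (x - y).

Section Simplex.
Variable k : nat.
Implicit Type v : 'I_k.+1 -> 'rV[R]_n.

Definition edge_mx v : 'M[R]_(k, n) :=
  \matrix_(i < k) (v (lift ord0 i) - v ord0).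

Definition affinely_independent v : bool := row_free (edge_mx v).

Definition convex_hull v : set 'rV[R]_n :=
  [set x | exists c : 'I_k.+1 -> R,
     [/\ forall i, 0 <= c i, \sum_i c i = 1 & x = \sum_i c i *: v i]].

Definition volume v : R :=
  Num.sqrt `|\det (\matrix_(i < k, j < k)
                dot (row i (edge_mx v)) (row j (edge_mx v)))| / k`!%:R.

(* The row space of this matrix is the orthogonal complement, for [dot], of the
   direction space of the simplex (see [dot_sig_mx]). *)
Definition orthogonal_space v : 'M[R]_n := orthomx idfun sig_mx (edge_mx v).

(* The dihedral angle at a codimension 2 face [v] is Euclidean. *)
Definition euclidean_angle v : Prop :=
  \rank (orthogonal_space v) = 2 /\
  forall x, (x <= orthogonal_space v)%MS -> x != 0 -> 0 < dot x x.

End Simplex.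

(* Congruence of the simplices as sets, so vertex labels may be permuted. *)
Definition congruent (v w : 'I_n.+1 -> 'rV[R]_n) : Prop :=
  exists2 f, isometry f & f @` convex_hull v = convex_hull w.

End PseudoEuclidean.

(* Main.v *)
Require Import Defs.
From HB Require Import structures.
From mathcomp Require Import all_boot all_order perm all_algebra.
From mathcomp Require Import all_classical all_reals all_analysis.
From mathcomp Require Import ring lra zify.
Set Implicit Arguments.
Unset Strict Implicit.
Unset Printing Implicit Defensive.
Import Order.TTheory GRing.Theory Num.Theory.
Import numFieldNormedType.Exports.
Local Open Scope classical_set_scope.
Local Open Scope ring_scope.

(** A nondegenerate n-simplex is encoded by the Gram matrix A of the gradients
    g_0, ..., g_n of its barycentric coordinates: A is symmetric, its rows add
    up to 0, and the submatrix A' that omits index 0 is invertible.  For i != j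
    put M_ij = A_ii A_jj - A_ij ^ 2.  The direction space of the (n-2)-face
    opposite to the vertices i and j is orthogonal to g_i and g_j, so:
    - the dihedral angle there is Euclidean as soon as A_ii > 0 and M_ij > 0
      ([face_euclidean_angle]);
    - by Jacobi's identity on complementary minors the squared volume of the
      face is a numerical constant times |M_ij| / |det A'| ([face_gram_det]).
    If A is multiplied by s, this ratio is multiplied by s ^ (2 - n), so a
    suitable s makes |det A'| harmless.  What is needed is therefore a curve
    A(t) along which every M_ij is constant and positive while A' stays
    invertible.

    Try A(t) = t X + Y / t with X_ij = +- P_i P_j and Y_ij = +- Q_i Q_j, the
    diagonal signs being +.  The terms in t ^ 2 and t ^ -2 of M_ij cancel and
    M_ij = (P_i Q_j -+ P_j Q_i) ^ 2 does not depend on t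
    ([gram_family_minor]).  The rows of X add up to 0 if the vertices are
    matched in pairs, P takes opposite values on the two vertices of a pair,
    and the off-diagonal sign is + exactly within pairs ([paired_form]);
    likewise for Y, with another matching. Take for X the pairs 0-1, 2-3, 4-5,
    ... and for Y the pairs 1-2, 3-4, ..., closed up by the pair n-0 if n is
    odd; the two matchings form a path through all the vertices if n is even, a
    cycle if n is odd. With P_i = +-1 on the matched vertices and Q of distinct
    absolute values on distinct pairs, every M_ij is positive
    ([cycle_minor_gt0]). Following a vector of the kernel of A(t) along the
    path or cycle shows that the vector is constant when t is small
    ([cycle_gram_kernel]); this is where each matching must cover more than 4
    vertices, hence n >= 5.

    By a continuous version of Lagrange's reduction of quadratic forms, the
    rescaled A(t) is, on a subinterval, the Gram matrix of continuously varying
    vectors in a fixed R^{p,n-p}, from which the simplices are recovered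
    ([continuous_congruence], [gram_realization]).  A congruence maps vertices
    to vertices, so it permutes the rows and columns of A; comparing the sum of
    all the M_ij gives the scale s, and then the trace of A gives t
    ([congruent_cycle_simplices]). *)

(** * Functions continuous on an open interval *)

Definition continuous_between (R : realType) (a b : R) (f : R -> R) :=
  forall t, a < t < b -> {for t, continuous f}.

Section ContinuousBetween.
Variables (R : realType) (a b : R).
Implicit Types f g : R -> R.

Lemma continuous_between_ext f g :
  continuous_between a b f -> f =1 g -> continuous_between a b g.
Proof. by move=> cf /funext <-. Qed.

Lemma continuous_between_cst c : continuous_between a b (fun=> c).
Proof. by move=> t _; apply: cvg_cst. Qed.

Lemma continuous_between_id : continuous_between a b id.
Proof. by move=> t _; apply: cvg_id. Qed.

Lemma continuous_betweenD f g : continuous_between a b f ->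
  continuous_between a b g -> continuous_between a b (fun t => f t + g t).
Proof. by move=> cf cg t abt; apply: (continuousD (cf t abt) (cg t abt)). Qed.

Lemma continuous_betweenN f : continuous_between a b f ->
  continuous_between a b (fun t => - f t).
Proof. by move=> cf t abt; apply: (continuousN (cf t abt)). Qed.

Lemma continuous_betweenM f g : continuous_between a b f ->
  continuous_between a b g -> continuous_between a b (fun t => f t * g t).
Proof. by move=> cf cg t abt; apply: (continuousM (cf t abt) (cg t abt)). Qed.

Lemma continuous_betweenV f : continuous_between a b f ->
  (forall t, a < t < b -> f t != 0) -> continuous_between a b (fun t => (f t)^-1).
Proof. by move=> cf f0 t abt; apply: (continuousV (f0 t abt) (cf t abt)). Qed.

Lemma continuous_between_comp f (h : R -> R) :
  (forall t, a < t < b -> {for f t, continuous h}) ->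
  continuous_between a b f -> continuous_between a b (fun t => h (f t)).
Proof.
by move=> ch cf t abt; apply: (continuous_comp (cf t abt) (ch t abt)).
Qed.

Lemma continuous_between_sum (I : Type) (r : seq I) (P : pred I) (F : I -> R -> R) :
  (forall i, continuous_between a b (F i)) ->
  continuous_between a b (fun t => \sum_(i <- r | P i) F i t).
Proof.
move=> cF; elim: r => [|i r IH].
  by apply: (continuous_between_ext (@continuous_between_cst 0)) => t; rewrite big_nil.
have [Pi|Pi] := boolP (P i).
  apply: (continuous_between_ext (continuous_betweenD (cF i) IH)) => t.
  by rewrite big_cons Pi.
by apply: (continuous_between_ext IH) => t; rewrite big_cons (negPf Pi).
Qed.

Lemma continuous_between_prod (I : Type) (r : seq I) (P : pred I) (F : I -> R -> R) :
  (forall i, continuous_between a b (F i)) ->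
  continuous_between a b (fun t => \prod_(i <- r | P i) F i t).
Proof.
move=> cF; elim: r => [|i r IH].
  by apply: (continuous_between_ext (@continuous_between_cst 1)) => t; rewrite big_nil.
have [Pi|Pi] := boolP (P i).
  apply: (continuous_between_ext (continuous_betweenM (cF i) IH)) => t.
  by rewrite big_cons Pi.
by apply: (continuous_between_ext IH) => t; rewrite big_cons (negPf Pi).
Qed.

Lemma continuous_between_mulmx m n p (A : R -> 'M[R]_(m, n)) (B : R -> 'M[R]_(n, p)) :
  (forall i j, continuous_between a b (fun t => A t i j)) ->
  (forall i j, continuous_between a b (fun t => B t i j)) ->
  forall i j, continuous_between a b (fun t => (A t *m B t) i j).
Proof.
move=> cA cB i j.
pose F k t := A t i k * B t k j.
have cF k : continuous_between a b (F k) by apply: continuous_betweenM.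
have := @continuous_between_sum _ (index_enum _) xpredT _ cF.
by move=> /continuous_between_ext; apply=> t; rewrite mxE.
Qed.

Lemma continuous_between_det n (A : R -> 'M[R]_n) :
  (forall i j, continuous_between a b (fun t => A t i j)) ->
  continuous_between a b (fun t => \det (A t)).
Proof.
move=> cA.
pose F (s : 'S_n) t := (-1) ^+ s * \prod_i A t i (s i).
have cF s : continuous_between a b (F s).
  apply: continuous_betweenM; first exact: continuous_between_cst.
  by apply: continuous_between_prod.
exact: (@continuous_between_sum _ (index_enum _) xpredT _ cF).
Qed.

Lemma continuous_between_invmx n (A : R -> 'M[R]_n) :
  (forall t, a < t < b -> A t \in unitmx) ->
  (forall i j, continuous_between a b (fun t => A t i j)) ->
  forall i j, continuous_between a b (fun t => invmx (A t) i j).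
Proof.
move=> uA cA i j t abt.
have cC : continuous_between a b
    (fun t => (\det (A t))^-1 * ((-1) ^+ (j + i) * \det (row' j (col' i (A t))))).
  apply: continuous_betweenM.
    apply: continuous_betweenV; first exact: continuous_between_det.
    by move=> u abu; have := uA _ abu; rewrite unitmxE unitfE.
  apply: continuous_betweenM; first exact: continuous_between_cst.
  apply: continuous_between_det => k l.
  by apply: (continuous_between_ext (cA (lift j k) (lift i l))) => u; rewrite !mxE.
have nearE : \forall u \near t, (\det (A u))^-1 *
    ((-1) ^+ (j + i) * \det (row' j (col' i (A u)))) = invmx (A u) i j.
  near=> u; rewrite /invmx uA; first by rewrite !mxE.
  near: u; have := near_in_itvoo (a := a) (b := b) (x := t).
  by rewrite in_itv /= => /(_ abt); apply: filterS => u; rewrite in_itv.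
have := cC t abt; rewrite /prop_for /continuous_at.
rewrite -(nbhs_singleton nearE).
by apply: cvg_trans; apply: near_eq_cvg; move: nearE; apply: filterS => u ->.
Unshelve. all: by end_near. Qed.

Lemma shrink_nonzero f c : a < c < b -> continuous_between a b f -> f c != 0 ->
  exists a' b' : R, [/\ a <= a', a' < b', b' <= b &
    forall t, a' < t < b' -> 0 < Num.sg (f c) * f t].
Proof.
move=> abc cf fc.
have cg : continuous_between a b (fun t => Num.sg (f c) * f t).
  by apply: continuous_betweenM => //; exact: continuous_between_cst.
have pos : 0 < Num.sg (f c) * f c by rewrite -normrEsg normr_gt0.
have /nbhs_ballP[e /= e0 ball_e] : \forall t \near c, 0 < Num.sg (f c) * f t.
  exact: (cvgr_gt _ (cg c abc) _ pos).
exists (Num.max a (c - e)), (Num.min b (c + e)).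
case/andP: abc => ac cb.
split; rewrite ?le_max ?ge_min ?lexx //.
  rewrite gt_max !lt_min; apply/andP; split; apply/andP; split; lra.
move=> t; rewrite gt_max lt_min => /andP[/andP[_ t1] /andP[_ t2]].
by apply: ball_e; rewrite /ball /= ltr_norml; lra.
Qed.

End ContinuousBetween.

Lemma continuous_betweenW (R : realType) (a b a' b' : R) (f : R -> R) :
  a <= a' -> b' <= b -> continuous_between a b f -> continuous_between a' b' f.
Proof.
move=> aa bb cf t /andP[at' tb]; apply: cf.
by rewrite (le_lt_trans aa at') (lt_le_trans tb bb).
Qed.

(** * Continuous diagonalization of symmetric matrices by congruence *)

Definition sign_mx (R : realType) n (d : 'I_n -> bool) : 'M[R]_n :=
  diag_mx (\row_i (if d i then 1 else -1)).

(** By polarization, a symmetric matrix with zero quadratic form is zero. *)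
Lemma symmetric_form_neq0 (R : realType) n (M : 'M[R]_n) :
  M^T = M -> M != 0 -> exists x : 'rV[R]_n, x *m M *m x^T != 0.
Proof.
move=> Msym; apply: contraNP => nx; apply/eqP.
have q0 (x : 'rV_n) : x *m M *m x^T = 0.
  by have [//|xx] := eqVneq (x *m M *m x^T) 0; case: nx; exists x.
have polar (x y : 'rV_n) : x *m M *m y^T = 0.
  have := q0 (x + y); rewrite linearD /= !mulmxDl !mulmxDr !q0 addr0 add0r.
  have -> : y *m M *m x^T = x *m M *m y^T.
    by rewrite [LHS]mx11_scalar -tr_scalar_mx -mx11_scalar !trmx_mul trmxK Msym mulmxA.
  move=> /matrixP/(_ 0 0); rewrite !mxE => h.
  by apply/matrixP => i j; rewrite !ord1 !mxE; lra.
apply/matrixP => i j; have := polar (delta_mx 0 i) (delta_mx 0 j).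
rewrite -rowE trmx_delta -colE => /matrixP/(_ 0 0).
by rewrite !mxE.
Qed.

(** The extended row basis of an anisotropic vector x is an invertible matrix
    whose first row is proportional to x. *)
Lemma basis_anisotropic_head (R : realType) n (M : 'M[R]_n.+1) :
  M^T = M -> M != 0 -> exists2 P, P \in unitmx & (P *m M *m P^T) 0 0 != 0.
Proof.
move=> Msym /(symmetric_form_neq0 Msym)[x xMx].
exists (row_ebase x); first exact: row_ebase_unit.
apply: contra xMx => /eqP P00; apply/eqP.
have xE : x = (col_ebase x 0 0 * (\rank x)%:R) *: row 0 (row_ebase x).
  rewrite -[LHS]mulmx_ebase [col_ebase x]mx11_scalar mul_scalar_mx mxE eqxx.
  rewrite mulr1n -scalemxAl -scalerA; congr (_ *: _).
  have : (\rank x <= 1)%N := rank_leq_row x.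
  case: (\rank x) => [|[|//]] _; first by rewrite pid_mx_0 mul0mx scale0r.
  rewrite scale1r rowE; congr (_ *m _).
  by apply/matrixP => i j; rewrite !mxE !ord1 /= andbT eq_sym.
rewrite xE -scalemxAl linearZ /= -scalemxAr -scalemxAl.
suff -> : row 0 (row_ebase x) *m M *m (row 0 (row_ebase x))^T = 0.
  by rewrite !scaler0.
apply/matrixP => i j; rewrite !ord1 [RHS]mxE -P00 -row_mul mxE [RHS]mxE.
by apply: eq_bigr => l _; congr (_ * _); [rewrite mxE | rewrite !mxE].
Qed.

(** Lagrange's reduction, performed on a whole interval at once: a constant
    change of basis makes the corner entry e nonzero at the midpoint, hence of
    constant sign on a smaller interval; there the Schur complement of e is
    again continuous, symmetric and invertible, and the induction applies to
    it.  The interval may shrink once for each dimension. *)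
Lemma continuous_congruence (R : realType) k (M : R -> 'M[R]_k) (a b : R) :
  a < b -> (forall i j, continuous_between a b (fun t => M t i j)) ->
  (forall t, a < t < b -> (M t)^T = M t /\ M t \in unitmx) ->
  exists (a' b' : R) (d : 'I_k -> bool) (C : R -> 'M[R]_k),
    [/\ a <= a', a' < b', b' <= b,
      forall i j, continuous_between a' b' (fun t => C t i j) &
      forall t, a' < t < b' -> M t = C t *m sign_mx R d *m (C t)^T].
Proof.
elim: k M a b => [|k IH] M a b ab cM Mprop.
  exists a, b, (fun=> true), (fun=> 0); split=> //.
    by move=> i j; apply: continuous_between_cst.
  by move=> t _; apply/matrixP => -[].
pose c := (a + b) / 2.
have abc : a < c < b by rewrite /c; lra.
have [Msym Munit] := Mprop c abc.
have M0 : M c != 0.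
  apply: contraTneq Munit => ->.
  by rewrite unitmxE det0 unitr0.
have [P Punit P00] := basis_anisotropic_head Msym M0.
pose M1 t : 'M[R]_(1 + k) := P *m M t *m P^T.
have cM1 i j : continuous_between a b (fun t => M1 t i j).
  move: i j; apply: continuous_between_mulmx; last first.
    by move=> i j; apply: continuous_between_cst.
  apply: continuous_between_mulmx => // i j; exact: continuous_between_cst.
pose e t := M1 t 0 0.
have [a1 [b1 [aa1 ab1 bb1 e_sg]]] := shrink_nonzero abc (cM1 0 0) P00.
have sub t : a1 < t < b1 -> a < t < b.
  by move=> /andP[at1 tb1]; rewrite (le_lt_trans aa1 at1) (lt_le_trans tb1 bb1).
have e0 t : a1 < t < b1 -> e t != 0.
  by move=> /e_sg; apply: contraTneq; rewrite -/(e t) => ->; rewrite mulr0 ltxx.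
pose r t : 'rV[R]_k := ursubmx (M1 t).
pose L t : 'M[R]_(1 + k) := block_mx 1%:M 0 ((e t)^-1 *: (r t)^T) 1%:M.
pose S t := drsubmx (M1 t) - (e t)^-1 *: ((r t)^T *m r t).
have M1E t : a1 < t < b1 ->
    M1 t = L t *m block_mx (e t)%:M 0 0 (S t) *m (L t)^T.
  move=> abt; have M1sym : (M1 t)^T = M1 t.
    by rewrite /M1 !trmx_mul trmxK (Mprop t (sub t abt)).1 mulmxA.
  rewrite /L tr_block_mx !trmx1 trmx0 linearZ /= trmxK !mulmx_block.
  rewrite !(mulmx0, mul0mx, mul1mx, mulmx1, addr0, add0r).
  rewrite -[LHS]submxK; congr block_mx.
  - apply/matrixP => i j; rewrite !ord1 [RHS]mxE eqxx mulr1n mxE mxE /e.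
    by congr (M1 t _ _); apply: val_inj.
  - by rewrite mul_scalar_mx scalerA mulfV ?e0 // scale1r.
  - rewrite mul_mx_scalar scalerA mulfV ?e0 // scale1r.
    by rewrite /r trmx_ursub M1sym.
  - rewrite mul_mx_scalar scalerA mulfV ?e0 // scale1r -scalemxAr.
    by rewrite /S addrC subrK.
have detM1 t : a1 < t < b1 -> \det (M1 t) = e t * \det (S t).
  move=> abt; rewrite M1E // !det_mulmx det_tr det_ublock det_lblock !det1.
  by rewrite det_scalar1 !mul1r mulr1.
have Sprop t : a1 < t < b1 -> (S t)^T = S t /\ S t \in unitmx.
  move=> abt; have [Mts Mtu] := Mprop t (sub t abt); split.
    rewrite /S linearB /= linearZ /= trmx_mul trmxK; congr (_ - _).
    by rewrite trmx_drsub /M1 !trmx_mul trmxK Mts mulmxA.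
  have : M1 t \in unitmx by rewrite !unitmx_mul unitmx_tr Punit Mtu.
  by rewrite !unitmxE detM1 // unitrM => /andP[].
have cW f : continuous_between a b f -> continuous_between a1 b1 f.
  exact: continuous_betweenW.
have ce : continuous_between a1 b1 e by apply: cW; apply: cM1.
have ceV : continuous_between a1 b1 (fun t => (e t)^-1).
  exact: continuous_betweenV.
have cr i j : continuous_between a1 b1 (fun t => r t i j).
  apply: cW; apply: (@continuous_between_ext _ _ _ _ _ (cM1 (lshift k i) (rshift 1 j))).
  by move=> t; rewrite !mxE.
have cS i j : continuous_between a1 b1 (fun t => S t i j).
  have cD : continuous_between a1 b1 (fun t => M1 t (rshift 1 i) (rshift 1 j) +
      - ((e t)^-1 * (r t 0 i * r t 0 j))).
    apply: continuous_betweenD; first by apply: cW; apply: cM1.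
    apply: continuous_betweenN; apply: continuous_betweenM => //.
    exact: continuous_betweenM.
  apply: (continuous_between_ext cD) => t.
  by rewrite !mxE big_ord1 !mxE.
have [a2 [b2 [d [C [aa2 ab2 bb2 cC SE]]]]] := IH S a1 b1 ab1 cS Sprop.
pose d1 (i : 'I_(1 + k)) : bool := if fintype.split i is inr j then d j else 0 < e c.
pose B t : 'M[R]_(1 + k) := block_mx (Num.sqrt `|e t|)%:M 0 0 (C t).
exists a2, b2, d1, (fun t => invmx P *m L t *m B t).
have cW2 f : continuous_between a1 b1 f -> continuous_between a2 b2 f.
  exact: continuous_betweenW.
have contL (i j : 'I_(1 + k)) : continuous_between a2 b2 (fun t => L t i j).
  rewrite -[i]fintype.splitK -[j]fintype.splitK.
  case: (fintype.split i) => i'; case: (fintype.split j) => j' /=.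
  - apply: (continuous_between_ext
      (@continuous_between_cst _ _ _ ((1%:M : 'M[R]_1) i' j'))) => t.
    by rewrite /L block_mxEul.
  - apply: (continuous_between_ext (@continuous_between_cst _ _ _ 0)) => t.
    by rewrite /L block_mxEur mxE.
  - have cEr : continuous_between a2 b2 (fun t => (e t)^-1 * r t j' i').
      by apply: cW2; apply: continuous_betweenM.
    by apply: (continuous_between_ext cEr) => t; rewrite /L block_mxEdl !mxE.
  - apply: (continuous_between_ext
      (@continuous_between_cst _ _ _ ((1%:M : 'M[R]_k) i' j'))) => t.
    by rewrite /L block_mxEdr.
have contB (i j : 'I_(1 + k)) : continuous_between a2 b2 (fun t => B t i j).
  rewrite -[i]fintype.splitK -[j]fintype.splitK.
  case: (fintype.split i) => i'; case: (fintype.split j) => j' /=.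
  - have csqrt : continuous_between a2 b2 (fun t => Num.sqrt `|e t|).
      apply: continuous_between_comp; first by move=> t _; apply: sqrt_continuous.
      apply: continuous_between_comp; first by move=> t _; apply: norm_continuous.
      exact: cW2.
    by apply: (continuous_between_ext csqrt) => t; rewrite /B block_mxEul !ord1 mxE.
  - apply: (continuous_between_ext (@continuous_between_cst _ _ _ 0)) => t.
    by rewrite /B block_mxEur mxE.
  - apply: (continuous_between_ext (@continuous_between_cst _ _ _ 0)) => t.
    by rewrite /B block_mxEdl mxE.
  - by apply: (continuous_between_ext (cC i' j')) => t; rewrite /B block_mxEdr.
split=> //.
- exact: le_trans aa1 aa2.
- exact: le_trans bb2 bb1.
- apply: continuous_between_mulmx; first apply: continuous_between_mulmx.
  + by move=> i j; apply: continuous_between_cst.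
  + exact: contL.
  + exact: contB.
- move=> t abt2.
  have abt : a1 < t < b1.
    case/andP: abt2 => at2 tb2.
    by rewrite (le_lt_trans aa2 at2) (lt_le_trans tb2 bb2).
  have signE : sign_mx R d1 = block_mx (if 0 < e c then 1 else -1)%:M 0 0 (sign_mx R d).
    rewrite /sign_mx; set row1 := \row_i _.
    rewrite -[row1]hsubmxK diag_mx_row; congr block_mx.
      apply/matrixP => i j; rewrite !mxE !ord1 /d1.
      by rewrite (fintype.unsplitK (inl _ : 'I_1 + 'I_k)%type).
    congr diag_mx; apply/matrixP => i j; rewrite !mxE /d1.
    by rewrite (fintype.unsplitK (inr _ : 'I_1 + 'I_k)%type).
  have BE : B t *m sign_mx R d1 *m (B t)^T = block_mx (e t)%:M 0 0 (S t).
    rewrite signE /B tr_block_mx !trmx0 tr_scalar_mx !mulmx_block.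
    rewrite !(mulmx0, mul0mx, addr0, add0r) -SE //; congr block_mx.
    rewrite -!scalar_mxM; congr (_%:M).
    rewrite mulrAC -expr2 sqr_sqrtr //.
    have := e_sg _ abt; rewrite -/(e t) -/(e c).
    case: (ltgtP 0 (e c)) => ec.
    + by rewrite gtr0_sg // mul1r => et; rewrite gtr0_norm // mulr1.
    + by rewrite ltr0_sg // mulN1r oppr_gt0 => et; rewrite ltr0_norm // mulrN1 opprK.
    + by rewrite -ec sgr0 mul0r ltxx.
  rewrite !trmx_mul.
  have -> : invmx P *m L t *m B t *m sign_mx R d1 *m
      ((B t)^T *m ((L t)^T *m (invmx P)^T)) =
    invmx P *m (L t *m (B t *m sign_mx R d1 *m (B t)^T) *m (L t)^T) *m (invmx P)^T.
    by rewrite !mulmxA.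
  rewrite BE -M1E // /M1 trmx_inv !mulmxA mulVmx // mul1mx -mulmxA mulmxV.
    by rewrite mulmx1.
  by rewrite unitmx_tr.
Qed.

(** The signature matrix [sig_mx] lists the positive directions first. *)
Lemma sign_mx_sorted (R : realType) n (d : 'I_n -> bool) :
  exists p (s : 'S_n), (p <= n)%N /\ forall C : 'M[R]_n,
    C *m sign_mx R d *m C^T = col_perm s C *m sig_mx R n p *m (col_perm s C)^T.
Proof.
pose l := [seq i <- enum 'I_n | d i] ++ [seq i <- enum 'I_n | ~~ d i].
have perm_l : perm_eq l (enum 'I_n).
  by rewrite /l; apply/permPl; apply: perm_filterC.
have size_l : size l = n by rewrite (perm_size perm_l) size_enum_ord.
have uniq_l : uniq l by rewrite (perm_uniq perm_l) enum_uniq.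
pose f (i : 'I_n) := tnth (tcast size_l (in_tuple l)) i.
have fE (i : 'I_n) x0 : f i = nth x0 l i.
  by rewrite /f (tnth_nth x0) /= val_tcast.
have f_inj : injective f.
  move=> i j; rewrite (fE i i) (fE j i) => /eqP.
  by rewrite nth_uniq ?size_l // => /eqP/val_inj.
exists (size [seq i <- enum 'I_n | d i]), (perm f_inj); split.
  by rewrite -[X in (_ <= X)%N]size_l size_cat leq_addr.
have df i : d (f i) = (i < size [seq i <- enum 'I_n | d i])%N.
  rewrite (fE i i) nth_cat; case: ltnP => h.
    by have := mem_nth i h; rewrite mem_filter => /andP[].
  have h2 : (i - size [seq i <- enum 'I_n | d i] <
      size [seq i <- enum 'I_n | ~~ d i])%N.
    by rewrite ltn_subLR // -size_cat size_l.
  by have := mem_nth i h2; rewrite mem_filter => /andP[/negbTE].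
move=> C; apply/matrixP => i j.
rewrite /sign_mx /sig_mx mxE [RHS]mxE (reindex_inj f_inj) /=.
apply: eq_bigr => k _; rewrite !mul_mx_diag !mxE permE df.
by [].
Qed.

(** * The product of a pseudo-Euclidean space *)

Section Dot.
Variables (R : realType) (n p : nat).
Implicit Types (x y z : 'rV[R]_n).

Lemma dotDl x y z : dot p (x + y) z = dot p x z + dot p y z.
Proof. by rewrite !dot_sig_mx !mulmxDl mxE. Qed.

Lemma dotZl a x y : dot p (a *: x) y = a * dot p x y.
Proof. by rewrite !dot_sig_mx -!scalemxAl mxE. Qed.

Lemma dotC x y : dot p x y = dot p y x.
Proof. by rewrite /dot; congr (_ - _); apply: eq_bigr => i _; rewrite mulrC. Qed.

Lemma dotNl x y : dot p (- x) y = - dot p x y.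
Proof. by rewrite -scaleN1r dotZl mulN1r. Qed.

Lemma dotBl x y z : dot p (x - y) z = dot p x z - dot p y z.
Proof. by rewrite dotDl dotNl. Qed.

Lemma dotDr x y z : dot p x (y + z) = dot p x y + dot p x z.
Proof. by rewrite dotC dotDl !(dotC x). Qed.

Lemma dotBr x y z : dot p x (y - z) = dot p x y - dot p x z.
Proof. by rewrite dotC dotBl !(dotC x). Qed.

Lemma dotZr a x y : dot p x (a *: y) = a * dot p x y.
Proof. by rewrite dotC dotZl dotC. Qed.

Lemma dot0l x : dot p 0 x = 0.
Proof. by rewrite -(scale0r 0) dotZl mul0r. Qed.

Lemma dot_suml (I : finType) (F : I -> 'rV[R]_n) y :
  dot p (\sum_i F i) y = \sum_i dot p (F i) y.
Proof.
by apply: (big_morph (dot p ^~ y)) => [u v|]; rewrite ?dotDl ?dot0l.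
Qed.

Lemma mulmx_sig_mx m1 m2 (A : 'M[R]_(m1, n)) (B : 'M[R]_(m2, n)) :
  A *m sig_mx R n p *m B^T = \matrix_(i, j) dot p (row i A) (row j B).
Proof.
apply/matrixP => i j; rewrite [RHS]mxE dot_sig_mx mxE [RHS]mxE.
apply: eq_bigr => k _; rewrite !mxE; congr (_ * _).
by apply: eq_bigr => l _; rewrite !mxE.
Qed.

Lemma sig_mx_sqr : sig_mx R n p *m sig_mx R n p = 1%:M.
Proof.
rewrite /sig_mx mul_mx_diag; apply/matrixP => i j; rewrite !mxE.
case: eqP => [->|_]; rewrite ?mulr0n ?mul0r // mulr1n.
by case: ifP; rewrite ?mulrNN mulr1.
Qed.

Lemma det_sig_mx_sqr : \det (sig_mx R n p) ^+ 2 = 1.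
Proof. by rewrite expr2 -det_mulmx sig_mx_sqr det1. Qed.

Lemma sig_mx_unit : sig_mx R n p \in unitmx.
Proof. by have [] := mulmx1_unit sig_mx_sqr. Qed.

Lemma dot_nondegenerate x : (forall y, dot p x y = 0) -> x = 0.
Proof.
move=> x0; apply/rowP => i; rewrite mxE.
have := x0 (delta_mx 0 i); rewrite dot_sig_mx trmx_delta -colE mxE.
rewrite /sig_mx mul_mx_diag !mxE.
by case: ifP; lra.
Qed.

End Dot.

Lemma norm_det_sig_mx (R : realType) n p : `|\det (sig_mx R n p)| = 1.
Proof.
apply/eqP; rewrite -(@eqrXn2 _ 2) ?normr_ge0 ?ler01 //.
by rewrite -normrX det_sig_mx_sqr normr1 expr1n.
Qed.

Lemma dot_le0_of_head0 (R : realType) n p (x : 'rV[R]_n.+1) :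
  (p < 2)%N -> x 0 ord0 = 0 -> dot p x x <= 0.
Proof.
move=> p2 x0; rewrite /dot big1 => [|i ip]; last first.
  suff -> : i = ord0 by rewrite x0 mul0r.
  by apply: val_inj => /=; lia.
by rewrite sub0r oppr_le0 sumr_ge0 // => i _; rewrite -expr2 sqr_ge0.
Qed.

Lemma binary_form_gt0 (R : realFieldType) (a b c s u : R) :
  0 < a -> 0 < a * c - b ^+ 2 -> (s != 0) || (u != 0) ->
  0 < a * s ^+ 2 + 2 * b * s * u + c * u ^+ 2.
Proof.
move=> a0 d0 su; rewrite -(pmulr_rgt0 _ a0).
have -> : a * (a * s ^+ 2 + 2 * b * s * u + c * u ^+ 2) =
  (a * s + b * u) ^+ 2 + (a * c - b ^+ 2) * u ^+ 2 by ring.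
have [u0|u0] := eqVneq u 0.
  move: su; rewrite u0 eqxx orbF mulr0 addr0 expr0n /= mulr0 addr0 => s0.
  by rewrite exprn_even_gt0 //= mulf_neq0 // gt_eqF.
by rewrite ltr_wpDl ?sqr_ge0 // mulr_gt0 // exprn_even_gt0.
Qed.

Lemma dot_comb (R : realType) n p (x y : 'rV[R]_n) (s u : R) :
  dot p (s *: x + u *: y) (s *: x + u *: y) =
  dot p x x * s ^+ 2 + 2 * dot p x y * s * u + dot p y y * u ^+ 2.
Proof. by rewrite !(dotDl, dotDr, dotZl, dotZr) (dotC p y x); ring. Qed.

(** A positive definite plane contains a nonzero vector with zero first
    coordinate, and for p < 2 the product of that vector with itself would not
    be positive. *)
Lemma index_ge2 (R : realType) n p (x y : 'rV[R]_n) :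
  0 < dot p x x -> 0 < dot p x x * dot p y y - dot p x y ^+ 2 -> (2 <= p)%N.
Proof.
case: n x y => [|n] x y x0 xy0; first by move: x0; rewrite /dot !big_ord0 subrr ltxx.
rewrite leqNgt; apply/negP => p2.
have [x00|x00] := eqVneq (x 0 ord0) 0.
  by have := dot_le0_of_head0 p2 x00; rewrite leNgt x0.
have z00 : (y 0 ord0 *: x + (- x 0 ord0) *: y) 0 ord0 = 0 by rewrite !mxE; ring.
have := dot_le0_of_head0 p2 z00.
by rewrite dot_comb leNgt binary_form_gt0 // oppr_eq0 x00 orbT.
Qed.

(** * Gradients of the barycentric coordinates *)

Section DualFrame.
Variables (R : realType) (n p : nat).
Implicit Types v w g h : 'I_n.+1 -> 'rV[R]_n.

(** This says that g i is the gradient of the i-th barycentric coordinate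
    of the simplex v. *)
Definition dual_frame v g := forall i j k,
  dot p (g i) (v j - v k) = (i == j)%:R - (i == k)%:R.

Lemma dual_frame_of v g :
  (forall i j, dot p (g i) (v j) = (i == j)%:R - (i == ord0)%:R) ->
  dual_frame v g.
Proof. by move=> h i j k; rewrite dotBr !h; ring. Qed.

Lemma dual_frame_edge v g : dual_frame v g ->
  edge_mx v *m (sig_mx R n p *m (\matrix_i g (lift ord0 i))^T) = 1%:M.
Proof.
move=> vg; rewrite mulmxA mulmx_sig_mx; apply/matrixP => i j.
rewrite !mxE !rowK dotC vg [lift _ j == ord0]eq_sym (negPf (neq_lift _ _)).
by rewrite subr0 (inj_eq lift_inj) eq_sym.
Qed.

Lemma edge_unit v g : dual_frame v g -> edge_mx v \in unitmx.
Proof. by move=> /dual_frame_edge/mulmx1_unit[]. Qed.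

Lemma dual_frame_affine v g : dual_frame v g -> affinely_independent v.
Proof. by move=> /edge_unit; rewrite /affinely_independent row_free_unit. Qed.

Lemma dual_frame_uniq v g h : dual_frame v g -> dual_frame v h -> g =1 h.
Proof.
move=> vg vh i; apply/eqP; rewrite -subr_eq0; apply/eqP.
have E : (g i - h i) *m (sig_mx R n p *m (edge_mx v)^T) = 0.
  rewrite mulmxA mulmx_sig_mx; apply/matrixP => a b.
  by rewrite !mxE row_id rowK dotBl vg vh subrr.
have U : sig_mx R n p *m (edge_mx v)^T \in unitmx.
  by rewrite unitmx_mul sig_mx_unit unitmx_tr (edge_unit vg).
by rewrite -[LHS](mulmxK U) E mul0mx.
Qed.

(** The coefficients depend on the labels only, which makes the constants in
    the volumes of the faces independent of the simplex. *)
Lemma edge_comb v i j : v i - v j =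
  (\row_l ((i == lift ord0 l)%:R - (j == lift ord0 l)%:R)) *m edge_mx v.
Proof.
have D k : v k - v ord0 = (\row_l (k == lift ord0 l)%:R) *m edge_mx v.
  case: (unliftP ord0 k) => [k' ->|->].
    rewrite -[LHS](rowK (fun i => v (lift ord0 i) - v ord0)) rowE; congr (_ *m _).
    by apply/rowP => l; rewrite !mxE eqxx /= (inj_eq lift_inj) eq_sym.
  rewrite subrr (_ : \row_l _ = 0) ?mul0mx //.
  by apply/rowP => l; rewrite !mxE (negPf (neq_lift _ _)).
have -> : v i - v j = (v i - v ord0) - (v j - v ord0) by rewrite opprB addrA subrK.
rewrite !D -mulmxBl; congr (_ *m _).
by apply/rowP => l; rewrite !mxE.
Qed.

End DualFrame.

(** * Volume and dihedral angle of a face of codimension 2 *)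

Section Face.
Variables (R : realType) (k p : nat).
Let n := (2 + k)%N.
Variables (e : 'I_k.+1 -> 'I_n.+1) (i j : 'I_n.+1).
Hypotheses (e_inj : injective e) (ij : i != j).
Hypotheses (ei : forall l, e l != i) (ej : forall l, e l != j).

(** The vertices i and j, which the face e omits, as one labeling. *)
Let pr (a : 'I_2) := if a == 0 then i else j.

Let pr_inj : injective pr.
Proof.
move=> a b; rewrite /pr; case: a => -[|[|//]] la; case: b => -[|[|//]] lb //= E;
  try exact: val_inj.
- by have := ij; rewrite E eqxx.
- by have := ij; rewrite E eqxx.
Qed.

Let e_pr l a : (e l == pr a) = false.
Proof. by apply/negbTE; rewrite /pr; case: ifP. Qed.

Section Blocks.
Variables (v g : 'I_n.+1 -> 'rV[R]_n).
Hypothesis vg : dual_frame p v g.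

Let S := sig_mx R n p.
Let F : 'M[R]_(k, n) := edge_mx (v \o e).
Let W : 'M[R]_(2, n) := \matrix_a (v (pr a) - v (e ord0)).
Let G : 'M[R]_(2, n) := \matrix_a g (pr a).
Let H : 'M[R]_(k, n) := \matrix_l g (e (lift ord0 l)).

Let FSH : F *m S *m H^T = 1%:M.
Proof.
rewrite mulmx_sig_mx; apply/matrixP => a b; rewrite !mxE !rowK dotC vg.
by rewrite !(inj_eq e_inj) (inj_eq lift_inj) [_ == ord0]eq_sym
  (negPf (neq_lift _ _)) subr0 eq_sym.
Qed.

Let FSG : F *m S *m G^T = 0.
Proof.
rewrite mulmx_sig_mx; apply/matrixP => a b; rewrite !mxE !rowK dotC vg.
by rewrite ![pr b == _]eq_sym /= !e_pr subrr.
Qed.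

Let WSH : W *m S *m H^T = 0.
Proof.
rewrite mulmx_sig_mx; apply/matrixP => a b; rewrite !mxE !rowK dotC vg.
by rewrite e_pr (inj_eq e_inj) [_ == ord0]eq_sym (negPf (neq_lift _ _)) subrr.
Qed.

Let WSG : W *m S *m G^T = 1%:M.
Proof.
rewrite mulmx_sig_mx; apply/matrixP => a b; rewrite !mxE !rowK dotC vg.
by rewrite [pr b == e _]eq_sym e_pr (inj_eq pr_inj) subr0 eq_sym.
Qed.

Let GSG : G *m S *m G^T = \matrix_(a, b) dot p (g (pr a)) (g (pr b)).
Proof. by rewrite mulmx_sig_mx; apply/matrixP => a b; rewrite !mxE !rowK. Qed.

Let trS : S^T = S. Proof. by rewrite /S /sig_mx tr_diag_mx. Qed.

Let ZSH : col_mx W F *m S *m (col_mx G H)^T = 1%:M.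
Proof.
rewrite tr_col_mx mul_col_mx mul_col_row WSG WSH FSG FSH.
by rewrite -scalar_mx_block.
Qed.

(** Jacobi's identity on complementary minors.  By [ZSH] the rows of G and H
    are dual to those of W and F.  Pairing the rows of G and F with those of G
    and H, respectively of W and F, gives block triangular matrices, whose
    determinants are the minor of g at i, j and the Gram determinant of the
    face; these two differ by the factor that turns (G, H) into (W, F). *)
Lemma face_gram_det_frame : \det (F *m S *m F^T) =
  (dot p (g i) (g i) * dot p (g j) (g j) - dot p (g i) (g j) ^+ 2) *
  \det S * \det (col_mx W F) ^+ 2.
Proof.
have YSH : \det (col_mx G F *m S *m (col_mx G H)^T) =
    dot p (g i) (g i) * dot p (g j) (g j) - dot p (g i) (g j) ^+ 2.
  rewrite tr_col_mx mul_col_mx mul_col_row FSG FSH det_ublock det1 mulr1 GSG.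
  rewrite (expand_det_row _ 0) !big_ord_recl big_ord0 addr0 /cofactor !det_mx11.
  by rewrite !mxE /pr /= (dotC p (g j) (g i)); ring.
have YSZ : \det (col_mx G F *m S *m (col_mx W F)^T) = \det (F *m S *m F^T).
  have GSW : G *m S *m W^T = 1%:M.
    by apply: trmx_inj; rewrite !trmx_mul trmxK trS mulmxA WSG trmx1.
  have GSF : G *m S *m F^T = 0.
    by apply: trmx_inj; rewrite !trmx_mul trmxK trS mulmxA FSG trmx0.
  by rewrite tr_col_mx mul_col_mx mul_col_row GSW GSF det_lblock det1 mul1r.
have := congr1 determinant ZSH; rewrite det1.
move: YSH YSZ; rewrite !det_mulmx !det_tr => <- <- E.
by rewrite -[LHS]mulr1 -E; ring.
Qed.

(** The gradients g i and g j span the orthogonal plane of the face: a vector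
    orthogonal to F has only components along G in the basis (G, H). *)
Lemma face_euclidean_angle : 0 < dot p (g i) (g i) ->
  0 < dot p (g i) (g i) * dot p (g j) (g j) - dot p (g i) (g j) ^+ 2 ->
  euclidean_angle p (v \o e).
Proof.
move=> gi0 m0.
have orthE : orthogonal_space p (v \o e) = kermx (S *m F^T).
  by rewrite /orthogonal_space /orthomx map_mx_id.
split.
  rewrite orthE mxrank_ker -mxrank_tr trmx_mul trmxK trS.
  have /eqP -> : row_free (F *m S) by apply/row_freeP; exists H^T.
  by rewrite addnK.
move=> x; rewrite orthE => /sub_kermxP; rewrite mulmxA => xF x0.
have SZH : S *m (col_mx W F)^T *m col_mx G H = 1%:M.
  by apply: trmx_inj; rewrite !trmx_mul trmxK trS trmx1; exact: mulmx1C ZSH.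
have [y xE] : exists y : 'rV_2, x = y *m G.
  exists (x *m S *m W^T).
  rewrite -[LHS]mulmx1 -SZH tr_col_mx !mulmxA mul_mx_row mul_row_col.
  by rewrite xF mul0mx addr0.
have xE2 : x = y 0 0 *: g i + y 0 1 *: g j.
  rewrite xE mulmx_sum_row !big_ord_recl big_ord0 addr0 !rowK.
  by congr (_ + y 0 _ *: _); apply: val_inj.
rewrite xE2 dot_comb binary_form_gt0 // -negb_and.
apply: contra x0 => /andP[/eqP y0 /eqP y1].
by rewrite xE2 y0 y1 !scale0r addr0.
Qed.

End Blocks.

(** The constant c is the determinant of the change of basis from the edges
    of the simplex to the basis (W, F) adapted to the face. *)
Lemma face_gram_det : exists c : R, forall v g, dual_frame p v g ->
  \det (\matrix_(a < k, b < k)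
     dot p (row a (edge_mx (v \o e))) (row b (edge_mx (v \o e)))) =
  (dot p (g i) (g i) * dot p (g j) (g j) - dot p (g i) (g j) ^+ 2) *
  \det (sig_mx R n p) * (c * \det (edge_mx v)) ^+ 2.
Proof.
pose coef (a b : 'I_n.+1) : 'rV[R]_n :=
  \row_l ((a == lift ord0 l)%:R - (b == lift ord0 l)%:R).
pose T : 'M[R]_(2 + k) := col_mx (\matrix_(a < 2) coef (pr a) (e ord0))
  (\matrix_(a < k) coef (e (lift ord0 a)) (e ord0)).
exists (\det T) => v g vg.
rewrite -mulmx_sig_mx (face_gram_det_frame vg) -det_mulmx /T mul_col_mx.
congr (_ * \det (col_mx _ _) ^+ 2); apply/row_matrixP => a.
  by rewrite row_mul !rowK edge_comb.
by rewrite row_mul !rowK edge_comb.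
Qed.

End Face.

(** * Congruent simplices have the same gradients up to relabeling *)

Section Congruence.
Variables (R : realType) (n p : nat).
Implicit Types v w g h : 'I_n.+1 -> 'rV[R]_n.

Lemma isometry_dot (f : 'rV[R]_n -> 'rV[R]_n) x y z : Defs.isometry p f ->
  dot p (f x - f z) (f y - f z) = dot p (x - z) (y - z).
Proof.
move=> [_ isom].
have polar (a b : 'rV[R]_n) :
    2 * dot p a b = dot p a a + dot p b b - dot p (a - b) (a - b).
  by rewrite !(dotBl, dotBr) (dotC p b a); ring.
have e : 2 * dot p (f x - f z) (f y - f z) = 2 * dot p (x - z) (y - z).
  have cancel (a b c : 'rV[R]_n) : (a - c) - (b - c) = a - b.
    by rewrite opprB addrA subrK.
  by rewrite !polar !cancel !isom.
by apply: (mulfI _ e); rewrite pnatr_eq0.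
Qed.

(** As f is onto and the product is nondegenerate, an equality of vectors may
    be tested against the differences f z - f 0. *)
Lemma isometry_affine (f : 'rV[R]_n -> 'rV[R]_n) (I : finType)
    (c : I -> R) (x : I -> 'rV[R]_n) : Defs.isometry p f -> \sum_i c i = 1 ->
  f (\sum_i c i *: x i) = \sum_i c i *: f (x i).
Proof.
move=> fi c1; apply/eqP; rewrite -subr_eq0; apply/eqP.
have [[f' _ f'K] _] := fi.
have shift (F : I -> 'rV[R]_n) z : \sum_i c i *: F i - z = \sum_i c i *: (F i - z).
  under [RHS]eq_bigr do rewrite scalerBr.
  by rewrite sumrB -scaler_suml c1 scale1r.
apply: (@dot_nondegenerate R n p) => y.
have -> : y = f (f' (y + f 0)) - f 0 by rewrite f'K addrK.
set z := f' _.
have -> : f (\sum_i c i *: x i) - \sum_i c i *: f (x i) =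
    (f (\sum_i c i *: x i) - f 0) - (\sum_i c i *: f (x i) - f 0).
  by rewrite opprB addrA subrK.
rewrite dotBl isometry_dot // 2!shift !dot_suml -sumrB big1 // => i _.
by rewrite !dotZl isometry_dot // subrr.
Qed.

Lemma dual_frame_barycentric v g (c : 'I_n.+1 -> R) i : dual_frame p v g ->
  \sum_j c j = 1 -> dot p (g i) (\sum_j c j *: v j - v ord0) = c i - (i == ord0)%:R.
Proof.
move=> vg c1.
have -> : \sum_j c j *: v j - v ord0 = \sum_j c j *: (v j - v ord0).
  under [RHS]eq_bigr do rewrite scalerBr.
  by rewrite sumrB -scaler_suml c1 scale1r.
rewrite dotC dot_suml.
under eq_bigr do rewrite dotZl dotC vg mulrBr.
rewrite sumrB -mulr_suml c1 mul1r (bigD1 i) //= eqxx mulr1 big1 ?addr0 //.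
by move=> j ji; rewrite eq_sym (negPf ji) mulr0.
Qed.

Lemma barycentric_uniq v g (c d : 'I_n.+1 -> R) : dual_frame p v g ->
  \sum_j c j = 1 -> \sum_j d j = 1 ->
  \sum_j c j *: v j = \sum_j d j *: v j -> c =1 d.
Proof.
move=> vg c1 d1 e i; apply: (addIr (- (i == ord0)%:R)).
by rewrite -!(dual_frame_barycentric i vg) // e.
Qed.

Lemma vertex_in_hull v i : convex_hull v (v i).
Proof.
exists (fun j => (j == i)%:R); split=> [j||]; first by case: eqP.
  by rewrite (bigD1 i) //= eqxx big1 ?addr0 // => j /negPf ->.
rewrite (bigD1 i) //= eqxx scale1r big1 ?addr0 // => j /negPf ->.
by rewrite scale0r.
Qed.

(** The vertices are the extreme points of the simplex: w j is a barycentric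
    combination of the points f (v i), and those which occur with a positive
    coefficient have to coincide with w j. *)
Lemma congruent_vertex v w h (f : 'rV[R]_n -> 'rV[R]_n) : dual_frame p w h ->
  Defs.isometry p f -> f @` convex_hull v = convex_hull w ->
  forall j, exists i, f (v i) = w j.
Proof.
move=> wh fi fvw j.
have : convex_hull w (w j) by apply: vertex_in_hull.
rewrite -fvw => -[x [c [c0 c1 ->]] fx].
have hull i : exists d : 'I_n.+1 -> R,
    [/\ forall i, 0 <= d i, \sum_i d i = 1 & f (v i) = \sum_i d i *: w i].
  suff : convex_hull w (f (v i)) by [].
  by rewrite -fvw; exists (v i) => //; exact: vertex_in_hull.
have [d dP] := choice hull.
have cd : (fun k => \sum_i c i * d i k) =1 (fun k => (k == j)%:R).
  apply: (barycentric_uniq wh).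
  - rewrite exchange_big /= -[RHS]c1; apply: eq_bigr => i _.
    by have [_ d1 _] := dP i; rewrite -mulr_sumr d1 mulr1.
  - by rewrite (bigD1 j) //= eqxx big1 ?addr0 // => i /negPf ->.
  - transitivity (w j).
      rewrite -fx isometry_affine //.
      under eq_bigr do rewrite scaler_suml.
      rewrite exchange_big /=; apply: eq_bigr => i _.
      have [_ _ ->] := dP i; rewrite scaler_sumr.
      by apply: eq_bigr => k _; rewrite scalerA.
    rewrite (bigD1 j) //= eqxx scale1r big1 ?addr0 // => i /negPf ->.
    by rewrite scale0r.
have [i ci] : exists i, c i != 0.
  apply/existsP; rewrite -negb_forall; apply/negP => /forallP c00.
  move: c1; rewrite big1 => [/eqP|i _]; first by rewrite eq_sym oner_eq0.
  exact/eqP.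
exists i; have [d0 d1 ->] := dP i.
have dk k : k != j -> d i k = 0.
  move=> kj; have := cd k; rewrite (negPf kj) => /eqP.
  rewrite psumr_eq0 => [/allP/(_ i)|l _]; last first.
    by rewrite mulr_ge0 //; have [] := dP l.
  by rewrite mem_index_enum mulf_eq0 (negPf ci) => /(_ isT)/eqP.
have dj : d i j = 1.
  by rewrite -d1 (bigD1 j) //= big1 ?addr0 // => k /dk.
rewrite (bigD1 j) //= dj scale1r big1 ?addr0 // => k /dk ->.
by rewrite scale0r.
Qed.

(** The linear part of the isometry maps the gradients of v to those of w,
    because gradients are characterized by their products with the edges. *)
Lemma congruent_gram v w g h : dual_frame p v g -> dual_frame p w h ->
  congruent p v w -> exists2 s : 'I_n.+1 -> 'I_n.+1, injective s &
    forall i j, dot p (h i) (h j) = dot p (g (s i)) (g (s j)).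
Proof.
move=> vg wh [f fi fvw].
have [s sP] := choice (congruent_vertex wh fi fvw).
have s_inj : injective s.
  move=> i j sij; apply/eqP; have := wh i i j.
  have -> : w i = w j by rewrite -!sP sij.
  rewrite subrr dotC dot0l eqxx; case: eqP => // _ /eqP.
  by rewrite subr0 eq_sym oner_eq0.
exists s => //.
have hE : h =1 (fun i => f (g (s i)) - f 0).
  apply: (dual_frame_uniq wh) => i j k; rewrite -!sP.
  have -> : f (v (s j)) - f (v (s k)) =
      (f (v (s j)) - f 0) - (f (v (s k)) - f 0) by rewrite opprB addrA subrK.
  rewrite dotBr !isometry_dot // !subr0 -dotBr vg.
  by rewrite !(inj_eq s_inj).
by move=> i j; rewrite !hE isometry_dot // !subr0.
Qed.

End Congruence.

Lemma omitted_pair k (e : 'I_k.+1 -> 'I_(2 + k).+1) : injective e ->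
  exists i j, [/\ i != j, forall l, e l != i & forall l, e l != j].
Proof.
move=> e_inj; pose A := [predC codom e].
have cardA : #|A| = 2.
  have := cardC (mem (codom e)); rewrite card_codom // !card_ord => cardE.
  by apply/eqP; rewrite -(eqn_add2l k.+1) cardE addnC.
have [i Ai] : exists i, i \in A by apply/card_gt0P; rewrite cardA.
have [j] : exists j, j \in [predD1 A & i].
  by apply/card_gt0P; have := cardD1 i A; rewrite Ai cardA add1n => -[<-].
rewrite !inE => /andP[ji Aj].
have off x l : x \in A -> e l != x.
  by rewrite inE; apply: contra => /eqP <-; exact: codom_f.
by exists i, j; split; rewrite 1?eq_sym // => l; apply: off.
Qed.

(** * Gram matrices with constant 2x2 principal minors *)

Section PairedForm.
Variables (R : realFieldType) (T : finType) (s : T -> T) (P : T -> R).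
Hypotheses (sK : involutive s) (Ps : forall i, P (s i) = - P i).

(** Twice the Laplacian of the matching s, with weight P i ^ 2 on the edge
    from i to s i, minus the rank one matrix P P^T.  Up to sign the entries are
    the P i * P j ([paired_formE]), and the rows add up to 0. *)
Definition paired_form i j : R :=
  2 * P i ^+ 2 * ((j == i)%:R - (j == s i)%:R) - P i * P j.

Definition pair_sign i j : R := if (j == i) || (j == s i) then 1 else -1.

Lemma weight_fixed i : s i = i -> P i = 0.
Proof. by move=> e; have := Ps i; rewrite e; lra. Qed.

Lemma paired_formE i j : paired_form i j = pair_sign i j * (P i * P j).
Proof.
rewrite /paired_form /pair_sign; case: (eqVneq j i) => [->|_] /=.
  by case: eqVneq => [/esym e|_] /=; rewrite ?(weight_fixed e); ring.
by case: eqVneq => [->|_] /=; rewrite ?Ps; ring.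
Qed.

Lemma pair_signC i j : pair_sign i j = pair_sign j i.
Proof.
rewrite /pair_sign [i == j]eq_sym; congr (if _ || _ then _ else _).
by apply/eqP/eqP => ->; rewrite sK.
Qed.

Lemma pair_sign_sqr i j : pair_sign i j ^+ 2 = 1.
Proof. by rewrite /pair_sign; case: ifP; rewrite ?sqrrN expr1n. Qed.

Lemma paired_formC i j : paired_form i j = paired_form j i.
Proof. by rewrite !paired_formE pair_signC (mulrC (P i)). Qed.

Lemma paired_form_diag i : paired_form i i = P i ^+ 2.
Proof. by rewrite paired_formE /pair_sign eqxx mul1r. Qed.

Lemma paired_form_sum (x : T -> R) i :
  \sum_j paired_form i j * x j =
  P i * (2 * (P i * (x i - x (s i))) - \sum_j P j * x j).
Proof.
have E j : paired_form i j * x j = 2 * P i ^+ 2 * ((j == i)%:R * x j)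
    - 2 * P i ^+ 2 * ((j == s i)%:R * x j) - P i * (P j * x j).
  by rewrite /paired_form; ring.
under eq_bigr do rewrite E.
rewrite 2!sumrB -!mulr_sumr.
have D k : \sum_j (j == k)%:R * x j = x k.
  rewrite (bigD1 k) //= eqxx mul1r big1 ?addr0 // => j /negPf ->.
  by rewrite mul0r.
rewrite !D; ring.
Qed.

Lemma sum_alternating (x : T -> R) :
  2 * (\sum_j P j * x j) = \sum_j P j * (x j - x (s j)).
Proof.
under [RHS]eq_bigr do rewrite mulrBr.
rewrite sumrB [X in _ - X](reindex_inj (inv_inj sK)) /=.
under [X in _ - X]eq_bigr do rewrite Ps sK mulNr.
by rewrite sumrN; ring.
Qed.

Lemma sum_weight : \sum_j P j = 0.
Proof.
have := sum_alternating (fun=> 1); rewrite [RHS]big1 => [|j _]; last by ring.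
by under eq_bigr do rewrite mulr1; lra.
Qed.

End PairedForm.

Section Family.
Variables (R : realFieldType) (T : finType).
Variables (s r : T -> T) (P Q : T -> R).
Hypotheses (sK : involutive s) (Ps : forall i, P (s i) = - P i).
Hypotheses (rK : involutive r) (Qr : forall i, Q (r i) = - Q i).

Definition gram_family (t : R) i j : R :=
  t * paired_form s P i j + t^-1 * paired_form r Q i j.

Lemma gram_familyC t i j : gram_family t i j = gram_family t j i.
Proof. by rewrite /gram_family (paired_formC sK) // (paired_formC rK). Qed.

Lemma gram_family_diag t i : gram_family t i i = t * P i ^+ 2 + t^-1 * Q i ^+ 2.
Proof. by rewrite /gram_family !paired_form_diag. Qed.

Lemma gram_family_sum t (x : T -> R) i : \sum_j gram_family t i j * x j =
  t * (P i * (2 * (P i * (x i - x (s i))) - \sum_j P j * x j)) +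
  t^-1 * (Q i * (2 * (Q i * (x i - x (r i))) - \sum_j Q j * x j)).
Proof.
rewrite -!paired_form_sum !mulr_sumr -big_split /=.
by apply: eq_bigr => j _; rewrite /gram_family; ring.
Qed.

Lemma gram_family_row0 t i : \sum_j gram_family t i j = 0.
Proof.
have mul1 (F : T -> R) : \sum_j F j * 1 = \sum_j F j.
  by apply: eq_bigr => j _; rewrite mulr1.
have := gram_family_sum t (fun=> 1) i.
by rewrite !mul1 (sum_weight sK Ps) (sum_weight rK Qr) => ->; ring.
Qed.

(** In each of the two forms the squared entry at i, j is the product of the
    diagonal entries at i and j, so the terms in t ^ 2 and t ^ -2 cancel. *)
Lemma gram_family_minor t i j : t != 0 ->
  gram_family t i i * gram_family t j j - gram_family t i j ^+ 2 =
  (P i * Q j - pair_sign R s i j * pair_sign R r i j * (P j * Q i)) ^+ 2.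
Proof.
move=> t0; rewrite !gram_family_diag /gram_family !paired_formE //.
have := pair_sign_sqr R s i j; have := pair_sign_sqr R r i j.
set a := pair_sign _ _ _ _; set b := pair_sign _ _ _ _ => a2 b2.
transitivity (t ^+ 2 * (P i * P j) ^+ 2 * (1 - b ^+ 2) +
  t^-1 ^+ 2 * (Q i * Q j) ^+ 2 * (1 - a ^+ 2) +
  (P i * Q j) ^+ 2 + (P j * Q i) ^+ 2
  - 2 * (b * a * (P i * Q j) * (P j * Q i))); first by field.
by rewrite sqrrB !exprMn a2 b2 !subrr; ring.
Qed.

End Family.

(** On the k matched vertices, P i * (x i - x (s i)) is half of Y, the sum of
    the P j * x j.  Summing over i counts every pair twice and gives
    2 * Y = k * Y / 2, so Y = 0 unless k = 4. *)
Lemma paired_form_kernel (R : realFieldType) (T : finType) (s : T -> T)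
    (P x : T -> R) : involutive s -> (forall i, P (s i) = - P i) ->
  (4 < #|[pred i | (P i != 0)%R]|)%N ->
  (forall i, P i * (2 * (P i * (x i - x (s i))) - \sum_j P j * x j) = 0) ->
  forall i, P i != 0 -> x (s i) = x i.
Proof.
move=> sK Ps card4; have := sum_alternating sK Ps x.
set Y := \sum_j P j * x j => Ysum ker.
have half i : P i * (x i - x (s i)) = Y / 2 * (P i != 0)%:R.
  have /eqP := ker i; rewrite mulf_eq0; case: eqP => [->|_] /=; first by lra.
  by move=> /eqP; lra.
have Y0 : Y = 0.
  have card : (\sum_i (P i != 0)%R)%N = #|[pred i | (P i != 0)%R]|.
    rewrite -sum1_card [RHS]big_mkcond; apply: eq_bigr => i _.
    by rewrite inE; case: eqP.
  move: Ysum; under eq_bigr do rewrite half.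
  rewrite -mulr_sumr -natr_sum card => Ysum.
  have : Y * (#|[pred i | (P i != 0)%R]|%:R - 4) = 0.
    by lra.
  move/eqP; rewrite mulf_eq0 => /orP[/eqP //|]; rewrite subr_eq0 eqr_nat.
  by move=> /eqP e; rewrite e in card4.
move=> i Pi; have /eqP := half i; rewrite Y0 mul0r mul0r mulf_eq0 (negPf Pi).
by rewrite subr_eq0 => /eqP.
Qed.

(** * Two matchings forming a path or a cycle *)

Section Cycle.
Variable n : nat.
Implicit Types i j : 'I_n.+1.

(** The pairs 0-1, 2-3, ...; when n is even, n remains alone. *)
Definition even_partner i : 'I_n.+1 :=
  inord (if odd i then i.-1 else if (i < n)%N then i.+1 else i).

(** The pairs 1-2, 3-4, ..., and n-0 when n is odd; when n is even, 0 remains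
    alone. *)
Definition odd_partner i : 'I_n.+1 :=
  inord (if odd i then if (i < n)%N then i.+1 else 0
         else if (0 < i)%N then i.-1 else if odd n then n else 0).

(** A numbering of the pairs of [odd_partner].  The term odd n keeps it
    positive on every pair, while an unmatched vertex 0 gets label 0. *)
Definition pair_label i : nat :=
  (if odd n && (i == n :> nat) then 0 else uphalf i) + odd n.

Lemma val_even_partner i : even_partner i =
  (if odd i then i.-1 else if (i < n)%N then i.+1 else i) :> nat.
Proof. by rewrite inordK //; have := ltn_ord i; do ?(case: ifP => //=); lia. Qed.

Lemma val_odd_partner i : odd_partner i =
  (if odd i then if (i < n)%N then i.+1 else 0
   else if (0 < i)%N then i.-1 else if odd n then n else 0) :> nat.
Proof. by rewrite inordK //; have := ltn_ord i; do ?(case: ifP => //=); lia. Qed.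

Lemma even_partnerK : involutive even_partner.
Proof.
move=> i; apply: val_inj; rewrite /= !val_even_partner.
by have := ltn_ord i; do ?(case: ifP => //=); lia.
Qed.

Lemma odd_partnerK : involutive odd_partner.
Proof.
move=> i; apply: val_inj; rewrite /= !val_odd_partner.
by have := ltn_ord i; do ?(case: ifP => //=); lia.
Qed.

Lemma odd_even_partner i : (i < n)%N || odd n -> odd (even_partner i) = ~~ odd i.
Proof.
by rewrite val_even_partner; have := ltn_ord i; do ?(case: ifP => //=); lia.
Qed.

Lemma odd_odd_partner i : (0 < i)%N || odd n -> odd (odd_partner i) = ~~ odd i.
Proof.
by rewrite val_odd_partner; have := ltn_ord i; do ?(case: ifP => //=); lia.
Qed.

Lemma pair_label_partner i : pair_label (odd_partner i) = pair_label i.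
Proof.
rewrite /pair_label val_odd_partner.
by have := ltn_ord i; do ?(case: ifP => //=); lia.
Qed.

Lemma pair_label_inj i j : pair_label i = pair_label j ->
  (j == i) || (j == odd_partner i).
Proof.
rewrite /pair_label -!val_eqE /= val_odd_partner.
by have := ltn_ord i; have := ltn_ord j; do ?(case: ifP => //=); lia.
Qed.

Lemma pair_label_gt0 i : (0 < i)%N || odd n -> (0 < pair_label i)%N.
Proof. by rewrite /pair_label; do ?(case: ifP => //=); lia. Qed.

End Cycle.

(** * The family of Gram matrices and its nondegeneracy *)

Section CycleFamily.
Variables (R : realFieldType) (n : nat).
Implicit Types i j : 'I_n.+1.

(** Both weights alternate in sign along the path or cycle and vanish at the
    vertex without a partner, if there is one. *)
Definition even_weight i : R := if (i < n)%N || odd n then (-1) ^+ i else 0.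

Definition odd_weight i : R := - ((-1) ^+ i * (pair_label i)%:R).

Lemma even_weight_partner i : even_weight (even_partner i) = - even_weight i.
Proof.
have h := @odd_even_partner n i; have lti := ltn_ord i.
have -> : even_weight (even_partner i) =
    if (i < n)%N || odd n then (-1) ^+ even_partner i else 0.
  rewrite /even_weight; congr (if _ then _ else _).
  by rewrite val_even_partner; do ?(case: ifP => //=); lia.
rewrite /even_weight -signr_odd -[in RHS]signr_odd.
by case: (boolP (_ || _)) h => [_ -> //|_ _]; rewrite ?signrN ?oppr0.
Qed.

Lemma odd_weight_partner i : odd_weight (odd_partner i) = - odd_weight i.
Proof.
rewrite /odd_weight pair_label_partner.
have h := @odd_odd_partner n i; case: (boolP ((0 < i)%N || odd n)) => hi.
  by rewrite -signr_odd h // signrN signr_odd mulNr.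
suff -> : pair_label i = 0%N by rewrite !mulr0 !oppr0.
by move: hi; rewrite /pair_label; case: odd => //=; lia.
Qed.

Lemma even_weight_sqr i : even_weight i ^+ 2 = ((i < n)%N || odd n)%:R.
Proof. by rewrite /even_weight; case: ifP; rewrite ?sqrr_sign ?expr0n. Qed.

Definition cycle_gram (t : R) i j : R :=
  gram_family (@even_partner n) (@odd_partner n) even_weight odd_weight t i j.

Definition cycle_minor i j : R :=
  (even_weight i * odd_weight j - pair_sign R (@even_partner n) i j *
     pair_sign R (@odd_partner n) i j * (even_weight j * odd_weight i)) ^+ 2.

Lemma cycle_gramC t i j : cycle_gram t i j = cycle_gram t j i.
Proof.
exact: (gram_familyC (@even_partnerK n) even_weight_partner
  (@odd_partnerK n) odd_weight_partner).
Qed.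

Lemma cycle_gram_row0 t i : \sum_j cycle_gram t i j = 0.
Proof.
exact: (gram_family_row0 (@even_partnerK n) even_weight_partner
  (@odd_partnerK n) odd_weight_partner).
Qed.

Lemma cycle_gram_minor t i j : t != 0 ->
  cycle_gram t i i * cycle_gram t j j - cycle_gram t i j ^+ 2 = cycle_minor i j.
Proof.
exact: (gram_family_minor even_weight_partner odd_weight_partner).
Qed.

Lemma cycle_gram_diag t i :
  cycle_gram t i i = t * even_weight i ^+ 2 + t^-1 * odd_weight i ^+ 2.
Proof. exact: (gram_family_diag even_weight_partner odd_weight_partner). Qed.

(** The absolute values of the two products differ, except when i and j have
    the same label and nonzero even weights.  Then i and j are odd partners and
    not even partners, so the two signs are opposite while both weights change
    sign from i to j, and the two products add up instead of cancelling. *)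
Lemma cycle_minor_gt0 i j : (1 < n)%N -> i != j -> 0 < cycle_minor i j.
Proof.
move=> n1 ij; rewrite exprn_even_gt0 //= subr_eq0.
have [/and3P[/eqP e hn hj]|ne] := boolP [&& pair_label i == pair_label j,
    (i < n)%N || odd n & (j < n)%N || odd n].
  have := pair_label_inj e; rewrite eq_sym (negPf ij) /= => /eqP jE.
  have hi : (0 < i)%N || odd n.
    have jnei : (j : nat) <> i by move=> /val_inj h; rewrite h eqxx in ij.
    move: jnei; rewrite jE val_odd_partner; have := ltn_ord i.
    by do ?(case: ifP => //=); lia.
  have sj : pair_sign R (@odd_partner n) i j = 1.
    by rewrite /pair_sign jE eqxx orbT.
  have si : pair_sign R (@even_partner n) i j = -1.
    rewrite /pair_sign eq_sym (negPf ij) /= -val_eqE /= val_even_partner jE.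
    rewrite val_odd_partner; case: ifP => // /eqP.
    by move: hi hn; have := ltn_ord i; do ?(case: ifP => //=); lia.
  have Wj : even_weight j = - even_weight i.
    rewrite /even_weight hn hj jE -signr_odd odd_odd_partner //.
    by rewrite signrN signr_odd.
  rewrite si sj mulr1 {1}jE odd_weight_partner Wj.
  have : even_weight i * odd_weight i != 0.
    rewrite mulf_neq0 //; first by rewrite /even_weight hn signr_eq0.
    by rewrite oppr_eq0 mulf_neq0 ?signr_eq0 // pnatr_eq0 -lt0n pair_label_gt0.
  by apply: contra => /eqP h; apply/eqP; move: h; lra.
apply/eqP => /(congr1 (fun x => `|x|)).
have normS s : `|pair_sign R s i j| = 1.
  by rewrite /pair_sign; case: ifP; rewrite ?normrN normr1.
have normO k : `|odd_weight k| = (pair_label k)%:R.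
  by rewrite normrN normrM normrX normrN1 expr1n mul1r normr_nat.
have normE k : `|even_weight k| = ((k < n)%N || odd n)%:R.
  by rewrite /even_weight; case: ifP; rewrite ?normr0 // normrX normrN1 expr1n.
rewrite !normrM !normS !normO !normE !mul1r -!natrM => /eqP; rewrite eqr_nat => /eqP.
move: (ltn_ord i) (ltn_ord j) ij ne; rewrite -val_eqE /= /pair_label.
by case: (odd n) => /=; do ?(case: ifP => //=); lia.
Qed.

Lemma cycle_gram_gt0 t i : (0 < n)%N -> 0 < t -> 0 < cycle_gram t i i.
Proof.
move=> n0 t0; rewrite cycle_gram_diag even_weight_sqr sqrrN exprMn sqrr_sign.
have [h|h] := boolP ((i < n)%N || odd n).
  by rewrite mulr1 ltr_pwDl // mulr_ge0 ?invr_ge0 ?mulr_ge0 ?sqr_ge0 // ltW.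
rewrite mulr0 add0r mul1r mulr_gt0 ?invr_gt0 // exprn_gt0 // ltr0n.
by rewrite pair_label_gt0 //; move: h; have := ltn_ord i; lia.
Qed.

Lemma card_even_weight : (4 < n)%N -> (4 < #|[pred i | (even_weight i != 0)%R]|)%N.
Proof.
move=> n4; apply: (@leq_trans #|predC1 (@ord_max n)|).
  by rewrite cardC1 card_ord.
apply: subset_leq_card; apply/fintype.subsetP => i; rewrite !inE -val_eqE /= => ni.
suff lti : (i < n)%N by rewrite /even_weight lti signr_eq0.
by have := ltn_ord i; lia.
Qed.

Lemma odd_weight_neq0 i : (0 < i)%N || odd n -> odd_weight i != 0.
Proof.
move=> h; rewrite oppr_eq0 mulf_neq0 ?signr_eq0 // pnatr_eq0 -lt0n.
exact: pair_label_gt0.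
Qed.

Lemma card_odd_weight : (4 < n)%N -> (4 < #|[pred i | (odd_weight i != 0)%R]|)%N.
Proof.
move=> n4; apply: (@leq_trans #|predC1 (@ord0 n)|).
  by rewrite cardC1 card_ord.
apply: subset_leq_card; apply/fintype.subsetP => i; rewrite !inE -val_eqE /= => ni.
by rewrite odd_weight_neq0 // lt0n ni.
Qed.

Section Kernel.
Variables (t : R) (x : 'I_n.+1 -> R).
Hypotheses (n4 : (4 < n)%N) (t0 : 0 < t) (tn : t * n.+1%:R < 1).
Hypothesis ker : forall i, \sum_j cycle_gram t i j * x j = 0.

(** The contributions of the two matchings to the i-th row of A(t) x are
    t * u i and w i / t.  Each of u and w changes sign between partners. *)
Let ep := @even_partner n.
Let op := @odd_partner n.
Let Y := \sum_j even_weight j * x j.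
Let Z := \sum_j odd_weight j * x j.
Let u i := even_weight i * (2 * (even_weight i * (x i - x (ep i))) - Y).
Let w i := odd_weight i * (2 * (odd_weight i * (x i - x (op i))) - Z).

Let uw i : t * u i + t^-1 * w i = 0.
Proof. by have := ker i; rewrite gram_family_sum. Qed.

Let u_ep i : u (ep i) = - u i.
Proof. by rewrite /u even_weight_partner /ep even_partnerK; ring. Qed.

Let w_op i : w (op i) = - w i.
Proof. by rewrite /w odd_weight_partner /op odd_partnerK; ring. Qed.

Let wE i : w i = - t ^+ 2 * u i.
Proof.
have -> : w i = t * (t * u i + t^-1 * w i) - t ^+ 2 * u i.
  by field; rewrite gt_eqF.
by rewrite uw; ring.
Qed.

Let lam := u ord0.

(** Consecutive vertices are partners for one of the two matchings, and both
    change the sign of u since w is a multiple of u. *)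
Let u_sign i : u i = (-1) ^+ i * lam.
Proof.
have u_op k : u (op k) = - u k.
  have t2 : - t ^+ 2 != 0 by rewrite oppr_eq0 expf_neq0 // gt_eqF.
  by apply: (mulfI t2); have := w_op k; rewrite !wE => ->; ring.
case: i => k; elim: k => [|k IH] lt_k.
  by rewrite expr0 mul1r; congr u; apply: val_inj.
have lt_k' : (k < n.+1)%N by apply: ltnW.
rewrite /= exprS -mulrA -(IH lt_k') mulN1r.
have [ok|ok] := boolP (odd k).
  rewrite -u_op; congr u; apply: val_inj; rewrite /= val_odd_partner /= ok.
  by rewrite -ltnS lt_k.
rewrite -u_ep; congr u; apply: val_inj; rewrite /= val_even_partner /=.
by rewrite (negPf ok) -ltnS lt_k.
Qed.

(** On a path, u vanishes at the last vertex, where the weight is 0. *)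
Let lam0_path : ~~ odd n -> lam = 0.
Proof.
move=> on; have /eqP := u_sign ord_max.
rewrite {1}/u {1 2}/even_weight ltnn (negPf on) mul0r eq_sym mulf_eq0.
by rewrite signr_eq0 => /eqP.
Qed.

(** On a cycle, u i and w i determine the differences of x along the edges
    in terms of Y, Z and lam.  Summing them against the weights yields three
    linear relations; eliminating Y and Z multiplies lam by a number that is
    positive since t is small. *)
Let lam0_cycle : odd n -> lam = 0.
Proof.
move=> on.
have P2 i : even_weight i ^+ 2 = 1 by rewrite even_weight_sqr on orbT.
have Psgn i : even_weight i = (-1) ^+ i by rewrite /even_weight on orbT.
pose c i : R := (pair_label i)%:R^-1.
have l0 i : (pair_label i)%:R != 0 :> R.
  by rewrite pnatr_eq0 -lt0n pair_label_gt0 // on orbT.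
have E1 i : 2 * (even_weight i * (x i - x (ep i))) = Y + lam.
  have : even_weight i * u i = lam.
    by rewrite u_sign -Psgn mulrA -expr2 P2 mul1r.
  by rewrite /u mulrA -expr2 P2; lra.
have E2 i : 2 * (odd_weight i * (x i - x (op i))) = Z + t ^+ 2 * lam * c i.
  have := wE i; rewrite u_sign /w.
  set v := 2 * _ => e.
  have : - (-1) ^+ i * (pair_label i)%:R * (v - Z) = - t ^+ 2 * ((-1) ^+ i * lam).
    by rewrite -e /odd_weight; ring.
  have s2 : (-1) ^+ i * (-1) ^+ i = 1 :> R by rewrite -expr2 sqrr_sign.
  move/(congr1 (fun z => - (-1) ^+ i * z * c i)).
  have -> : - (-1) ^+ i * (- (-1) ^+ i * (pair_label i)%:R * (v - Z)) * c i =
    ((-1) ^+ i * (-1) ^+ i) * ((pair_label i)%:R * c i) * (v - Z) by ring.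
  have -> : - (-1) ^+ i * (- t ^+ 2 * ((-1) ^+ i * lam)) * c i =
    ((-1) ^+ i * (-1) ^+ i) * (t ^+ 2 * lam * c i) by ring.
  by rewrite s2 mulfV // !mul1r; lra.
have E3 i : 2 * (even_weight i * (x i - x (op i))) =
    - (c i * (Z + t ^+ 2 * lam * c i)).
  rewrite -E2 Psgn /odd_weight /c; field; exact: l0.
pose N : R := n.+1%:R; pose C1 := \sum_i c i; pose C2 := \sum_i c i ^+ 2.
(* F1 sums the even edges against the even weights and F2 the odd edges
   against the odd weights; F3 sums the odd edges against the even weights,
   which is possible because those alternate all around the cycle. *)
have F1 : 4 * Y = N * (Y + lam).
  have := sum_alternating (@even_partnerK n) even_weight_partner x.
  move/(congr1 ( *%R 2)); rewrite [RHS]mulr_sumr.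
  rewrite (eq_bigr _ (fun i _ => E1 i)).
  by rewrite sumr_const card_ord -/Y -[RHS]mulr_natl -/N; lra.
have F2 : 4 * Z = N * Z + t ^+ 2 * lam * C1.
  have := sum_alternating (@odd_partnerK n) odd_weight_partner x.
  move/(congr1 ( *%R 2)); rewrite [RHS]mulr_sumr.
  rewrite (eq_bigr _ (fun i _ => E2 i)).
  rewrite big_split /= -mulr_sumr sumr_const card_ord -/Z -[_ *+ _]mulr_natl -/N.
  by rewrite -/C1; lra.
have F3 : 4 * Y = - (C1 * Z + t ^+ 2 * lam * C2).
  have even_op i : even_weight (op i) = - even_weight i.
    by rewrite !Psgn -signr_odd odd_odd_partner ?on ?orbT // signrN signr_odd.
  have := sum_alternating (@odd_partnerK n) even_op x.
  move/(congr1 ( *%R 2)); rewrite [RHS]mulr_sumr.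
  rewrite (eq_bigr _ (fun i _ => E3 i)).
  rewrite sumrN -/Y.
  have -> : \sum_i c i * (Z + t ^+ 2 * lam * c i) = C1 * Z + t ^+ 2 * lam * C2.
    rewrite /C1 /C2 mulr_suml mulr_sumr -big_split /=.
    by apply: eq_bigr => i _; ring.
  by lra.
have C2N : C2 <= N.
  rewrite /N -[n.+1]card_ord -sum1_card natr_sum; apply: ler_sum => i _.
  by rewrite expr_le1 ?invr_ge0 // invf_le1 ?ltr0n ?ler1n // lt0n -(pnatr_eq0 R).
have C2_ge0 : 0 <= C2 by apply: sumr_ge0 => i _; apply: sqr_ge0.
have N5 : 5 <= N by rewrite /N ler_nat; lia.
have key : lam * (4 * N + t ^+ 2 * C1 ^+ 2 - t ^+ 2 * (N - 4) * C2) = 0.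
  have -> : lam * (4 * N + t ^+ 2 * C1 ^+ 2 - t ^+ 2 * (N - 4) * C2) =
    4 * (N * (Y + lam) - 4 * Y)
    + (N - 4) * (- (C1 * Z + t ^+ 2 * lam * C2) - 4 * Y)
    + C1 * (N * Z + t ^+ 2 * lam * C1 - 4 * Z) by ring.
  by rewrite -F1 -F2 -F3 !subrr; ring.
move/eqP: key; rewrite mulf_eq0 => /orP[/eqP //|].
suff : 0 < 4 * N + t ^+ 2 * C1 ^+ 2 - t ^+ 2 * (N - 4) * C2.
  by move=> /gt_eqF ->.
have tN2 : t ^+ 2 * N ^+ 2 <= 1.
  by rewrite -exprMn expr_le1 // ?mulr_ge0 ?ler0n // ltW.
have : t ^+ 2 * (N - 4) * C2 <= 1.
  apply: le_trans tN2; rewrite -mulrA ler_pM2l ?exprn_gt0 // expr2.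
  by rewrite ler_pM //; lra.
have : 0 <= t ^+ 2 * C1 ^+ 2 by rewrite mulr_ge0 ?sqr_ge0.
by lra.
Qed.

Lemma cycle_gram_kernel i j : x i = x j.
Proof.
have lam0 : lam = 0 by case: (boolP (odd n)) => /= [/lam0_cycle|/lam0_path].
have u0 k : u k = 0 by rewrite u_sign lam0 mulr0.
have w0 k : w k = 0 by rewrite wE u0 mulr0.
have xe := paired_form_kernel (@even_partnerK n) even_weight_partner
  (card_even_weight n4) u0.
have xo := paired_form_kernel (@odd_partnerK n) odd_weight_partner
  (card_odd_weight n4) w0.
suff x0 k : x k = x ord0 by rewrite !x0.
case: k => k; elim: k => [|k IH] lt_k; first by congr x; apply: val_inj.
have lt_k' : (k < n.+1)%N by apply: ltnW.
have kn : (k < n)%N by rewrite -ltnS.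
rewrite -(IH lt_k'); have [ok|ok] := boolP (odd k).
  rewrite -(xo (Ordinal lt_k')); last by rewrite odd_weight_neq0 //= odd_gt0.
  by congr x; apply: val_inj; rewrite /= val_odd_partner /= ok kn.
rewrite -(xe (Ordinal lt_k')); last by rewrite /even_weight /= kn signr_eq0.
by congr x; apply: val_inj; rewrite /= val_even_partner /= (negPf ok) kn.
Qed.

End Kernel.

End CycleFamily.

(** * Simplices with a prescribed Gram matrix *)

Section SimplexOfGradients.
Variables (R : realType) (n p : nat).
Variable G : 'M[R]_n.

(** The rows of G are the gradients of all barycentric coordinates but the
    first; the gradients add up to 0 as the coordinates add up to 1. *)
Definition gradients (i : 'I_n.+1) : 'rV[R]_n :=
  if unlift ord0 i is Some l then row l G else - \sum_l row l G.

(** The first vertex is the origin, and the others form the dual basis of the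
    rows of G. *)
Definition simplex_of_gradients (i : 'I_n.+1) : 'rV[R]_n :=
  if unlift ord0 i is Some l then row l (invmx (G *m sig_mx R n p))^T else 0.

Lemma gradients_dual : G \in unitmx ->
  dual_frame p simplex_of_gradients gradients.
Proof.
move=> Gu; apply: dual_frame_of => i j.
have GSu : G *m sig_mx R n p \in unitmx by rewrite unitmx_mul Gu sig_mx_unit.
have E l m : dot p (row l G) (row m (invmx (G *m sig_mx R n p))^T) = (l == m)%:R.
  have := mulmxV GSu; rewrite -[X in _ *m X = _]trmxK mulmx_sig_mx.
  by move=> /matrixP/(_ l m); rewrite !mxE.
rewrite /gradients /simplex_of_gradients.
case: (unliftP ord0 j) => [j' ->|->]; last by rewrite dotC dot0l subrr.
case: (unliftP ord0 i) => [i' ->|->].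
  rewrite E (inj_eq lift_inj) [lift _ _ == ord0]eq_sym (negPf (neq_lift _ _)).
  by rewrite subr0.
rewrite dotNl dot_suml (bigD1 j') //= E eqxx big1 => [|l /negPf lj].
  by rewrite addr0 sub0r.
by rewrite E lj.
Qed.

Lemma gradients_gram (A : 'I_n.+1 -> 'I_n.+1 -> R) :
  (forall i j, A i j = A j i) -> (forall i, \sum_j A i j = 0) ->
  G *m sig_mx R n p *m G^T = \matrix_(i, j) A (lift ord0 i) (lift ord0 j) ->
  forall i j, dot p (gradients i) (gradients j) = A i j.
Proof.
move=> Asym Arow; rewrite mulmx_sig_mx => /matrixP GA.
have A0 i : A i ord0 = - \sum_l A i (lift ord0 l).
  by have := Arow i; rewrite big_ord_recl => /eqP; rewrite addr_eq0 => /eqP.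
have E l m : dot p (row l G) (row m G) = A (lift ord0 l) (lift ord0 m).
  by have := GA l m; rewrite !mxE.
have E0 l : dot p (row l G) (- \sum_m row m G) = A (lift ord0 l) ord0.
  rewrite dotC dotNl dot_suml A0; congr (- _); apply: eq_bigr => m _.
  by rewrite dotC E.
move=> i j; rewrite /gradients.
case: (unliftP ord0 i) => [i' ->|->]; case: (unliftP ord0 j) => [j' ->|->] //.
  by rewrite dotC E0 Asym.
rewrite dotNl dot_suml A0; congr (- _); apply: eq_bigr => l _.
by rewrite E0 Asym.
Qed.

Lemma edge_det_sqr : G \in unitmx ->
  \det (edge_mx simplex_of_gradients) ^+ 2 * \det G ^+ 2 = 1.
Proof.
move=> Gu; have := congr1 determinant (dual_frame_edge (gradients_dual Gu)).
have -> : \matrix_i gradients (lift ord0 i) = G.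
  by apply/row_matrixP => l; rewrite rowK /gradients liftK.
rewrite !det_mulmx det_tr det1 => /(congr1 (fun x => x ^+ 2)).
by rewrite expr1n !exprMn det_sig_mx_sqr mul1r.
Qed.

End SimplexOfGradients.

Lemma face_data (R : realType) n k p (e : 'I_k.+1 -> 'I_n.+1) :
  n = (2 + k)%N -> injective e ->
  exists i j (c : R), i != j /\ forall v g, dual_frame p v g ->
    let m := dot p (g i) (g i) * dot p (g j) (g j) - dot p (g i) (g j) ^+ 2 in
    volume p (v \o e) =
      Num.sqrt `|m * \det (edge_mx v) ^+ 2 * c| / k`!%:R /\
    (0 < dot p (g i) (g i) -> 0 < m -> euclidean_angle p (v \o e)).
Proof.
move=> nk; subst n => e_inj.
have [i [j [ij ei ej]]] := omitted_pair e_inj.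
have [c cP] := face_gram_det R p e_inj ij ei ej.
exists i, j, (c ^+ 2); split=> // v g vg m; split; last first.
  exact: face_euclidean_angle.
rewrite /volume (cP v g vg) -/m; congr (Num.sqrt _ / _).
by rewrite exprMn !normrM norm_det_sig_mx mulr1 -[in RHS]mulrA [X in _ = _ * X]mulrC.
Qed.

Lemma continuous_rV (R : realType) n (a b : R) (f : R -> 'rV[R]_n) :
  (forall j, continuous_between a b (fun t => f t 0 j)) ->
  forall t, a < t < b -> {for t, continuous f}.
Proof.
move=> cf t abt; apply/cvg_mx_entourageP => A entA.
apply: filter_forall => i; apply: filter_forall => j; rewrite ord1.
have near_j : \forall u \near t, A (f t 0 j, f u 0 j).
  by have /cvg_entourageP/(_ A entA) := cf j t abt.
suff : \forall u \near t, (f t 0 j, f u 0 j) \in A by [].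
by move: near_j; apply: filterS => u; rewrite in_setE.
Qed.

Lemma cycle_gram_unit (R : realFieldType) n (t : R) :
  (4 < n)%N -> 0 < t -> t * n.+1%:R < 1 ->
  \matrix_(i < n, j < n) cycle_gram t (lift ord0 i) (lift ord0 j) \in unitmx.
Proof.
move=> n4 t0 tn; rewrite -row_free_unit; apply: inj_row_free => x xA.
pose y (i : 'I_n.+1) : R := if unlift ord0 i is Some l then x 0 l else 0.
have y0 : y ord0 = 0 by rewrite /y unlift_none.
have yl l : y (lift ord0 l) = x 0 l by rewrite /y liftK.
have kerl l : \sum_j cycle_gram t (lift ord0 l) j * y j = 0.
  rewrite big_ord_recl y0 mulr0 add0r.
  have /matrixP/(_ 0 l) := xA; rewrite [RHS]mxE mxE; apply: etrans.
  by apply: eq_bigr => m _; rewrite yl mxE mulrC cycle_gramC.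
have ker i : \sum_j cycle_gram t i j * y j = 0.
  case: (unliftP ord0 i) => [l -> //|->].
  have : \sum_i \sum_j cycle_gram t i j * y j = 0.
    rewrite exchange_big big1 //= => j _; rewrite -mulr_suml.
    under eq_bigr do rewrite cycle_gramC.
    by rewrite cycle_gram_row0 mul0r.
  by rewrite big_ord_recl [X in _ + X]big1 ?addr0 // => l _; apply: kerl.
apply/rowP => l; rewrite mxE -yl -y0.
exact: (cycle_gram_kernel n4 t0 tn ker).
Qed.

(** The trace has the form t * SP + SQ / t with SP <= n + 1 and 1 <= SQ, hence
    it is decreasing for these t. *)
Lemma cycle_trace_inj (R : realFieldType) n (t u : R) :
  (0 < n)%N -> 0 < t -> t * n.+1%:R < 1 -> 0 < u -> u * n.+1%:R < 1 ->
  \sum_(i < n.+1) cycle_gram t i i = \sum_(i < n.+1) cycle_gram u i i -> t = u.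
Proof.
move=> n0 t0 tn u0 un.
pose SP : R := \sum_(i < n.+1) even_weight R i ^+ 2.
pose SQ : R := \sum_(i < n.+1) odd_weight R i ^+ 2.
have trE w : \sum_(i < n.+1) cycle_gram w i i = w * SP + w^-1 * SQ.
  rewrite /SP /SQ !mulr_sumr -big_split /=.
  by apply: eq_bigr => i _; rewrite cycle_gram_diag.
have SPn : SP <= n.+1%:R.
  rewrite -[n.+1]card_ord -sum1_card natr_sum; apply: ler_sum => i _.
  by rewrite even_weight_sqr lern1 leq_b1.
have SQ1 : 1 <= SQ.
  rewrite /SQ (bigD1 (lift ord0 (Ordinal n0))) //= -[X in X <= _]addr0 lerD //.
    rewrite sqrrN exprMn sqrr_sign mul1r -natrX ler1n expn_gt0.
    by rewrite pair_label_gt0.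
  by rewrite sumr_ge0 // => i _; apply: sqr_ge0.
rewrite !trE => e.
have n1 : 1 <= n.+1%:R :> R by rewrite ler1n.
have tu : t * u * SP < SQ.
  have t1 : t < 1 by apply: le_lt_trans tn; rewrite ler_peMr // ltW.
  have uSP : u * SP < 1 by apply: le_lt_trans un; rewrite ler_pM2l.
  apply: lt_le_trans SQ1; rewrite -mulrA.
  apply: le_lt_trans uSP.
  rewrite ler_piMl //; last exact: ltW.
  by rewrite mulr_ge0 ?(ltW u0) // sumr_ge0 // => i _; apply: sqr_ge0.
have : (t - u) * (SQ - t * u * SP) = 0.
  have -> : (t - u) * (SQ - t * u * SP) =
      t * u * ((u * SP + u^-1 * SQ) - (t * SP + t^-1 * SQ)).
    by field; rewrite !gt_eqF.
  by rewrite e subrr mulr0.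
move=> /eqP; rewrite mulf_eq0 subr_eq0 => /orP[/eqP //|].
by rewrite gt_eqF // subr_gt0.
Qed.

(** The solution is s = |d| ^ (- 1 / (n - 2)).  For d the determinant of a
    Gram matrix A of gradients, the squared face volumes, which are
    proportional to the minors of order 2 of s * A over the determinant of
    s * A, become proportional to the minors of A. *)
Lemma normalizing_scale (R : realType) n (a b : R) (d : R -> R) : (2 < n)%N ->
  continuous_between a b d -> (forall t, a < t < b -> d t != 0) ->
  exists2 s : R -> R, continuous_between a b s &
    forall t, a < t < b -> 0 < s t /\ s t ^+ n * `|d t| = s t ^+ 2.
Proof.
move=> n2 cd d0; exists (fun t => expR (- ln `|d t| / (n - 2)%:R)).
  apply: continuous_between_comp; first by move=> t _; apply: continuous_expR.
  apply: continuous_betweenM; last exact: continuous_between_cst.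
  apply: continuous_betweenN; apply: continuous_between_comp.
    by move=> t /d0 dt; apply: continuous_ln; rewrite normr_gt0.
  by apply: continuous_between_comp => // t _; apply: norm_continuous.
move=> t /d0 dt; split; first exact: expR_gt0.
have -> : n = (2 + (n - 2))%N by lia.
rewrite exprD -mulrA -[RHS]mulr1 addKn; congr (_ * _).
rewrite -expRM_natr divfK; last by rewrite pnatr_eq0; lia.
by rewrite expRN lnK ?mulVf ?normr_eq0 // posrE normr_gt0.
Qed.

(** On a subinterval [continuous_congruence] writes A as C S C^T with S the
    signature matrix, so the rows of C, rescaled, serve as gradients.  The last
    conclusion expresses the normalization in terms of the simplex: s ^ 2 is
    the inverse of the squared volume of its edge parallelepiped. *)
Lemma gram_realization (R : realType) n (a b : R)
    (A : R -> 'I_n.+1 -> 'I_n.+1 -> R) :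
  (2 < n)%N -> a < b ->
  (forall i j, continuous_between a b (fun t => A t i j)) ->
  (forall t i j, A t i j = A t j i) -> (forall t i, \sum_j A t i j = 0) ->
  (forall t, a < t < b ->
     \matrix_(i < n, j < n) A t (lift ord0 i) (lift ord0 j) \in unitmx) ->
  exists (a' b' : R) (p : nat) (Q g : R -> 'I_n.+1 -> 'rV[R]_n) (s : R -> R),
    [/\ a <= a', a' < b', b' <= b, (p <= n)%N &
      forall i t, a' < t < b' -> {for t, continuous (Q ^~ i)}] /\
    forall t, a' < t < b' ->
      [/\ dual_frame p (Q t) (g t), 0 < s t,
        forall i j, dot p (g t i) (g t j) = s t * A t i j &
        s t ^+ 2 * \det (edge_mx (Q t)) ^+ 2 = 1].
Proof.
move=> n2 ab cA Asym Arow.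
set B := fun t => \matrix_(i < n, j < n) A t (lift ord0 i) (lift ord0 j).
move=> Bu.
have Bsym t : (B t)^T = B t by apply/matrixP => i j; rewrite !mxE.
have cB i j : continuous_between a b (fun t => B t i j).
  apply: (continuous_between_ext (cA (lift ord0 i) (lift ord0 j))) => t.
  by rewrite mxE.
have [a' [b' [d [C [aa ab' bb cC CE]]]]] := continuous_congruence ab cB
  (fun t abt => conj (Bsym t) (Bu t abt)).
have [p [pi [pn piE]]] := sign_mx_sorted R d.
have sub t : a' < t < b' -> a < t < b.
  by move=> /andP[at' tb]; rewrite (le_lt_trans aa at') (lt_le_trans tb bb).
have [s cs sP] : exists2 s : R -> R, continuous_between a' b' s &
    forall t, a' < t < b' -> 0 < s t /\ s t ^+ n * `|\det (B t)| = s t ^+ 2.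
  apply: normalizing_scale => //.
    by apply: continuous_between_det => i j; apply: continuous_betweenW (cB i j).
  by move=> t /sub/Bu; rewrite unitmxE unitfE.
pose G t : 'M[R]_n := Num.sqrt (s t) *: col_perm pi (C t).
have GE t : a' < t < b' -> G t *m sig_mx R n p *m (G t)^T = s t *: B t.
  move=> abt; have [s0 _] := sP t abt; rewrite (CE t abt) piE /G linearZ /=.
  by rewrite -!scalemxAl -scalemxAr scalerA -expr2 sqr_sqrtr // ltW.
have Gu t : a' < t < b' -> G t \in unitmx.
  move=> abt; have [s0 _] := sP t abt; have : s t *: B t \in unitmx.
    by rewrite unitmxZ ?Bu ?sub // unitfE gt_eqF.
  by rewrite -GE // !unitmx_mul => /andP[/andP[]].
have cG i j : continuous_between a' b' (fun t => G t i j).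
  have cE : continuous_between a' b' (fun t => Num.sqrt (s t) * C t i (pi j)).
    apply: continuous_betweenM => //.
    by apply: continuous_between_comp cs => t _; apply: sqrt_continuous.
  by apply: (continuous_between_ext cE) => t; rewrite !mxE.
have cV i j : continuous_between a' b' (fun t => invmx (G t *m sig_mx R n p) i j).
  apply: continuous_between_invmx => [t abt|].
    by rewrite unitmx_mul Gu // sig_mx_unit.
  by apply: continuous_between_mulmx => // k l; apply: continuous_between_cst.
exists a', b', p, (fun t => simplex_of_gradients p (G t)).
exists (fun t => gradients (G t)), s; split.
  split; [exact: aa | exact: ab' | exact: bb | exact: pn | move=> i].
  apply: continuous_rV => j.
  rewrite /simplex_of_gradients; case: (unliftP ord0 i) => [l _|_].
    by apply: (continuous_between_ext (cV j l)) => t; rewrite !mxE.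
  apply: (continuous_between_ext (@continuous_between_cst R a' b' 0)) => t.
  by rewrite mxE.
move=> t abt; have [s0 sE] := sP t abt; split=> //.
- by apply: gradients_dual; apply: Gu.
- apply: gradients_gram => [i j|i|]; first by rewrite Asym.
    by rewrite -mulr_sumr Arow mulr0.
  by rewrite GE //; apply/matrixP => i j; rewrite !mxE.
have := edge_det_sqr p (Gu t abt); rewrite mulrC => <-; congr (_ * _).
have := congr1 determinant (GE t abt).
rewrite !det_mulmx det_tr [\det (s t *: _)]detZ => /(congr1 Num.norm).
rewrite !normrM (gtr0_norm (exprn_gt0 n s0)) sE norm_det_sig_mx mulr1 => <-.
by rewrite -expr2 real_normK ?num_real.
Qed.

Lemma gram_sum_perm (R : realType) n m p (g h : 'I_n -> 'rV[R]_m)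
    (s : 'I_n -> 'I_n) : injective s ->
  (forall i j, dot p (h i) (h j) = dot p (g (s i)) (g (s j))) ->
  forall F : R -> R -> R -> R,
  \sum_i \sum_j F (dot p (h i) (h i)) (dot p (h j) (h j)) (dot p (h i) (h j)) =
  \sum_i \sum_j F (dot p (g i) (g i)) (dot p (g j) (g j)) (dot p (g i) (g j)).
Proof.
move=> s_inj hg F; rewrite [RHS](reindex_inj s_inj) /=.
apply: eq_bigr => i _; rewrite [RHS](reindex_inj s_inj) /=.
by apply: eq_bigr => j _; rewrite !hg.
Qed.

(** * The family of simplices *)

Lemma scaled_minor (R : realType) n m p (g : 'I_n.+1 -> 'rV[R]_m) (x t : R) :
  t != 0 -> (forall i j, dot p (g i) (g j) = x * cycle_gram t i j) ->
  forall i j,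
    dot p (g i) (g i) * dot p (g j) (g j) - dot p (g i) (g j) ^+ 2 =
    x ^+ 2 * cycle_minor R i j.
Proof.
by move=> t0 gE i j; rewrite !gE -(cycle_gram_minor i j t0); ring.
Qed.

(** A congruence permutes the Gram matrices of the gradients.  The sum of all
    the minors is x ^ 2 times a constant, so x = y; then the traces of the
    unscaled Gram matrices agree. *)
Lemma congruent_cycle_simplices (R : realType) n p
    (v w g h : 'I_n.+1 -> 'rV[R]_n) (x y s t : R) :
  (1 < n)%N -> dual_frame p v g -> dual_frame p w h -> 0 < x -> 0 < y ->
  0 < s -> s * n.+1%:R < 1 -> 0 < t -> t * n.+1%:R < 1 ->
  (forall i j, dot p (g i) (g j) = x * cycle_gram s i j) ->
  (forall i j, dot p (h i) (h j) = y * cycle_gram t i j) ->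
  congruent p v w -> s = t.
Proof.
move=> n1 vg wh x0 y0 s0 sn t0 tn gE hE vw.
have [r r_inj gr] := congruent_gram vg wh vw.
pose M : R := \sum_(i < n.+1) \sum_(j < n.+1) cycle_minor R i j.
have M0 : 0 < M.
  have m_ge0 i j : 0 <= cycle_minor R i j :> R by apply: sqr_ge0.
  rewrite /M (bigD1 ord0) //= (bigD1 ord_max) //= -addrA.
  rewrite ltr_pwDl ?addr_ge0 ?sumr_ge0 // => [|i _]; last exact: sumr_ge0.
  by rewrite cycle_minor_gt0 // -val_eqE /= eq_sym -lt0n ltnW.
have sumE k z u : u != 0 ->
    (forall i j, dot p (k i) (k j) = z * cycle_gram u i j) ->
    \sum_(i < n.+1) \sum_(j < n.+1)
      (dot p (k i) (k i) * dot p (k j) (k j) - dot p (k i) (k j) ^+ 2) =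
    z ^+ 2 * M.
  move=> u0 kE; rewrite /M mulr_sumr; apply: eq_bigr => i _.
  by rewrite mulr_sumr; apply: eq_bigr => j _; apply: scaled_minor u0 kE _ _.
have xy : x = y.
  have := gram_sum_perm r_inj gr (fun a b c => a * b - c ^+ 2).
  rewrite (sumE _ _ _ _ (lt0r_neq0 s0) gE) (sumE _ _ _ _ (lt0r_neq0 t0) hE).
  move=> /(mulIf (lt0r_neq0 M0)) /eqP.
  by rewrite eqrXn2 ?ltW // => /eqP.
apply: (cycle_trace_inj (ltnW n1) s0 sn t0 tn).
apply: (mulfI (lt0r_neq0 x0)); rewrite [in RHS]xy !mulr_sumr.
rewrite (reindex_inj r_inj) /=; apply: eq_bigr => i _.
by rewrite -gE -hE gr.
Qed.

(* A k-face is given by an injective labeling of its k.+1 vertices. *)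
Theorem theorem1p3 (R : realType) (n : nat) (hn : (5 <= n)%N) :
  exists (p : nat) (I : interval R) (Q : R -> 'I_n.+1 -> 'rV[R]_n),
    (2 <= p <= n)%N /\
    (exists a b : R, [/\ a \in I, b \in I & a < b]) /\
    (forall i : 'I_n.+1,
       {within [set` I], continuous (fun t : R => Q t i)}) /\
    (forall t : R, t \in I -> affinely_independent (Q t)) /\
    (forall s t : R, s \in I -> t \in I -> s <> t ->
       ~ congruent p (Q s) (Q t)) /\
    (forall f : 'I_(n - 2).+1 -> 'I_n.+1, injective f ->
       forall s t : R, s \in I -> t \in I ->
         volume p (Q s \o f) = volume p (Q t \o f)) /\
    (forall f : 'I_(n - 2).+1 -> 'I_n.+1, injective f ->
       forall t : R, t \in I -> euclidean_angle p (Q t \o f)).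
Proof.
have n2 : (2 < n)%N by apply: leq_trans hn.
have n1 : (1 < n)%N := ltnW n2.
pose A (t : R) := cycle_gram t (n := n).
pose T : R := n.+1%:R^-1.
have T0 : 0 < T by rewrite invr_gt0 ltr0n.
have small t : 0 < t < T -> 0 < t /\ t * n.+1%:R < 1.
  by move=> /andP[t0 tT]; split=> //; rewrite -ltr_pdivlMr ?ltr0n // div1r.
have cA i j : continuous_between 0 T (fun t => A t i j).
  apply: continuous_betweenD; apply: continuous_betweenM;
    try exact: continuous_between_cst; first exact: continuous_between_id.
  apply: continuous_betweenV; first exact: continuous_between_id.
  by move=> t /andP[t0 _]; rewrite gt_eqF.
have Au t : 0 < t < T ->
    \matrix_(i < n, j < n) A t (lift ord0 i) (lift ord0 j) \in unitmx.
  by move=> /small[t0 tn]; apply: cycle_gram_unit.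
have [a [b [p [Q [g [s [[a0 ab bT pn cQ] QP]]]]]]] := gram_realization
  n2 T0 cA (@cycle_gramC R n) (@cycle_gram_row0 R n) Au.
have inT t : a < t < b -> 0 < t /\ t * n.+1%:R < 1.
  move=> /andP[at' tb]; apply: small.
  by rewrite (le_lt_trans a0 at') (lt_le_trans tb bT).
have minorE t : a < t < b -> forall i j,
    dot p (g t i) (g t i) * dot p (g t j) (g t j) - dot p (g t i) (g t j) ^+ 2 =
    s t ^+ 2 * cycle_minor R i j.
  move=> abt; have [t0 _] := inT t abt; have [_ _ gE _] := QP t abt.
  exact: scaled_minor (lt0r_neq0 t0) gE.
have diag_gt0 t : a < t < b -> forall i, 0 < dot p (g t i) (g t i).
  move=> abt i; have [t0 _] := inT t abt; have [_ s0 gE _] := QP t abt.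
  by rewrite gE mulr_gt0 ?cycle_gram_gt0 // ltnW.
have minor_gt0 t : a < t < b -> forall i j, i != j ->
    0 < dot p (g t i) (g t i) * dot p (g t j) (g t j) - dot p (g t i) (g t j) ^+ 2.
  move=> abt i j ij; have [_ s0 _ _] := QP t abt; rewrite minorE //.
  by apply: mulr_gt0; [apply: exprn_gt0 | apply: cycle_minor_gt0].
have nE : n = (2 + (n - 2))%N by lia.
have mid : a < (a + b) / 2 < b by lra.
exists p, `]a, b[%R, Q.
split; [|split; [|split; [|split; [|split; [|split]]]]].
- rewrite pn andbT.
  apply: (index_ge2 (diag_gt0 _ mid ord0) (minor_gt0 _ mid ord0 ord_max _)).
  by rewrite -val_eqE /= eq_sym -lt0n ltnW.
- by exists ((a + b) / 2), ((a + 3 * b) / 4); rewrite !in_itv /=; split; lra.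
- move=> i; apply: continuous_in_subspaceT => t.
  by rewrite inE /= in_itv /=; apply: cQ.
- by move=> t; rewrite in_itv /= => /QP[/dual_frame_affine].
- move=> u t; rewrite !in_itv /= => abu abt ut uvt; apply: ut.
  have [u0 un] := inT u abu; have [t0 tn] := inT t abt.
  have [vg su gE _] := QP u abu; have [wh st hE _] := QP t abt.
  exact: (congruent_cycle_simplices n1 vg wh su st u0 un t0 tn gE hE uvt).
- move=> f f_inj u t; rewrite !in_itv /= => abu abt.
  have [i [j [c [ij volE]]]] := face_data R p nE f_inj.
  have {}volE w : a < w < b -> volume p (Q w \o f) =
      Num.sqrt `|cycle_minor R i j * c| / (n - 2)`!%:R.
    move=> abw; have [vg _ _ edgeE] := QP w abw.
    rewrite (volE _ _ vg).1; congr (Num.sqrt `|_ * _| / _).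
    by rewrite minorE // mulrAC edgeE mul1r.
  by rewrite !volE.
- move=> f f_inj t; rewrite in_itv /= => abt.
  have [i [j [c [ij angle]]]] := face_data R p nE f_inj.
  have [vg _ _ _] := QP t abt.
  by apply: (angle _ _ vg).2; [exact: diag_gt0 | exact: minor_gt0].
Qed.
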